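(* Let $p=p_n$ be a sequence of positive integers. Assume that for each $n$ the rows of $X_n\in\mathbb R^{n\times p}$ are i.i.d. $N(0,\tilde\Sigma_n)$, where $$c_m\le\inf_{n\ge1}\lambda_{\min}(\tilde\Sigma_n)\le\sup_{n\ge1}\lambda_{\max}(\tilde\Sigma_n)\le c_M$$ for constants $0<c_m\le c_M<\infty$. Let $S_n=\frac1nX_n^\top X_n$ and $b\in\operatorname{range}(X_n^\top)$. Fix $\varepsilon\in(0,1)$ and consider the gradient descent iterates $\{\theta^{(t)}\}_{t\ge0}$ for $g_n(\theta)=\frac12\theta^\top S_n\theta-b^\top\theta$ with step size $\eta=1/\lambda_{\max}(S_n)$, initialized at $\theta^{(0)}\in\operatorname{range}(S_n)$. Then the iteration complexity $T_{\varepsilon,n}$ satisfies, for every $n$, $$T_{\varepsilon,n}\le\kappa(X_n)^2\log\left(\frac1\varepsilon\right)+1.$$ Moreover, if $p/n\to\gamma\in[0,\infty)\setminus\{1\}$ as $n\to\infty$, there exists a constant $C>0$ (depending only on $c_m,c_M$ and $\gamma$) such that for all sufficiently large $n$, $$\mathbb E[T_{\varepsilon,n}]\le C\log\left(\frac1\varepsilon\right)+1.$$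
   Context: For a matrix $A\in\mathbb R^{n\times p}$, $s_{\max}(A)$ is its largest singular value, $s_{\min}(A)$ its $\min(n,p)$-th singular value in descending order, and $\kappa(A)=s_{\max}(A)/s_{\min}(A)$; $\operatorname{range}(A)$ is the column space. Under the stated assumptions $X_n$ has rank $\min(n,p)$ almost surely, so all quantities are well defined almost surely. $\lambda_{\min},\lambda_{\max}$ are the smallest and largest eigenvalues of a symmetric matrix. The vector $b$ is known and may depend on the data. The gradient descent iterates are $\theta^{(t+1)}=\theta^{(t)}-\eta\nabla g_n(\theta^{(t)})=\theta^{(t)}-\eta(S_n\theta^{(t)}-b)$. Set $\theta_n^\star=S_n^{-1}b$ if $p\le n$ and $\theta_n^\star=S_n^+b$ (Moore--Penrose pseudo-inverse) if $p>n$. The iteration complexity is $$T_{\varepsilon,n}=\inf\{t\in\{0,1,2,\dots\}: g_n(\theta^{(t)})-g_n(\theta_n^\star)\le\varepsilon(g_n(\theta^{(0)})-g_n(\theta_n^\star))\}.$$ *)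

(* Defs.v *)
From HB Require Import structures.
From mathcomp Require Import all_boot all_order all_algebra.
From mathcomp Require Import all_classical all_reals all_analysis.
Import Order.TTheory GRing.Theory Num.Theory.
Import numFieldNormedType.Exports.

Set Implicit Arguments.
Unset Strict Implicit.
Unset Printing Implicit Defensive.

Local Open Scope classical_set_scope.
Local Open Scope ring_scope.

Section Spectrum.
Context {R : realType}.

(* A symmetric matrix of positive size has a nonempty finite set of real
   eigenvalues, so this supremum and this infimum are attained. *)
Definition lambda_max (n : nat) (A : 'M[R]_n) : R :=
  sup [set a | eigenvalue A a].

Definition lambda_min (n : nat) (A : 'M[R]_n) : R :=
  inf [set a | eigenvalue A a].

(* Eigenvalues with multiplicity, in descending order; the list is unique, and
   it exists as soon as char_poly A splits over R, e.g. for A symmetric. *)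
Definition eigenvalues_desc (n : nat) (A : 'M[R]_n) : seq R :=
  xget [::] [set s : seq R |
    sorted >=%R s /\ char_poly A = \prod_(a <- s) ('X - a%:P)].

(* The index k counts from 0. *)
Definition singular_value (n p : nat) (A : 'M[R]_(n, p)) (k : nat) : R :=
  Num.sqrt (eigenvalues_desc (A^T *m A))`_k.

Definition s_max (n p : nat) (A : 'M[R]_(n, p)) : R := singular_value A 0.

Definition s_min (n p : nat) (A : 'M[R]_(n, p)) : R :=
  singular_value A (minn n p).-1.

Definition kappa (n p : nat) (A : 'M[R]_(n, p)) : R := s_max A / s_min A.

Definition col_range (n p : nat) (A : 'M[R]_(n, p)) : set 'cV[R]_n :=
  range (fun u : 'cV[R]_p => A *m u).

Definition is_moore_penrose (n p : nat) (A : 'M[R]_(n, p)) (B : 'M[R]_(p, n))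
    : Prop :=
  [/\ A *m B *m A = A, B *m A *m B = B,
      (A *m B)^T = A *m B & (B *m A)^T = B *m A].

(* Not mathcomp's pinvmx, which is only a partial inverse on the row space.
   The Moore-Penrose inverse exists and is unique for every real matrix. *)
Definition moore_penrose (n p : nat) (A : 'M[R]_(n, p)) : 'M[R]_(p, n) :=
  xget 0 [set B | is_moore_penrose A B].

End Spectrum.

Section GradientDescent.
Context {R : realType} (n p : nat).
Implicit Types (X : 'M[R]_(n, p)) (b theta : 'cV[R]_p).

Definition sample_cov X : 'M[R]_p := n%:R^-1 *: (X^T *m X).

Definition objective X b theta : R :=
  2^-1 * (theta^T *m sample_cov X *m theta) 0 0 - (b^T *m theta) 0 0.

Definition step_size X : R := (lambda_max (sample_cov X))^-1.

Definition gd_iterate X b (theta0 : 'cV[R]_p) (t : nat) : 'cV[R]_p :=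
  iter t (fun theta => theta - step_size X *: (sample_cov X *m theta - b))
    theta0.

Definition optimum X b : 'cV[R]_p :=
  if (p <= n)%N then invmx (sample_cov X) *m b
  else moore_penrose (sample_cov X) *m b.

(* Extended-real valued: the infimum of the empty set is +oo. *)
Definition iteration_complexity (eps : R) X b (theta0 : 'cV[R]_p) : \bar R :=
  ereal_inf [set t%:R%:E | t in [set t : nat |
    objective X b (gd_iterate X b theta0 t) - objective X b (optimum X b)
    <= eps * (objective X b theta0 - objective X b (optimum X b))]].

End GradientDescent.

Section RandomMatrices.
Context {d : measure_display} {Omega : measurableType d} {R : realType}.
Variable P : probability Omega R.

Definition random_matrix (m k : nat) (X : Omega -> 'M[R]_(m, k)) : Prop :=
  forall i j, measurable_fun setT (fun w => X w i j).

(* The sigma-algebra on Omega generated by a random vector. *)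
Definition sigma_of (k : nat) (x : Omega -> 'cV[R]_k) : set (set Omega) :=
  g_sigma_preimage (fun (i : 'I_k) w => x w i 0).

Definition mutually_independent (I : finType) (F : I -> set (set Omega))
    : Prop :=
  forall (J : {set I}) (E : I -> set Omega),
    (forall i, i \in J -> F i (E i)) ->
    P (\bigcap_(i in [set` J]) E i) = (\prod_(i in J) P (E i))%E.

Definition standard_normal_vector (k : nat) (z : Omega -> 'cV[R]_k) : Prop :=
  [/\ random_matrix z,
      forall i (B : set R), measurable B ->
        P ((fun w => z w i 0) @^-1` B) = normal_prob 0 1 B &
      mutually_independent (fun i : 'I_k =>
        sigma_of (fun w => (z w i 0)%:M : 'cV[R]_1))].

(* x ~ N(0, Sigma): x = A z with z standard normal and Sigma = A A^T. Taking z
   on the sample space of x is no restriction when Sigma is invertible, since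
   then z = Sigma^(-1/2) x is such a vector. *)
Definition centered_gaussian_vector (k : nat) (Sigma : 'M[R]_k)
    (x : Omega -> 'cV[R]_k) : Prop :=
  exists (l : nat) (A : 'M[R]_(k, l)) (z : Omega -> 'cV[R]_l),
    [/\ standard_normal_vector z, Sigma = A *m A^T & forall w, x w = A *m z w].

Definition iid_gaussian_rows (n p : nat) (Sigma : 'M[R]_p)
    (X : Omega -> 'M[R]_(n, p)) : Prop :=
  mutually_independent (fun i : 'I_n => sigma_of (fun w => (row i (X w))^T)) /\
  forall i : 'I_n, centered_gaussian_vector Sigma (fun w => (row i (X w))^T).

End RandomMatrices.

Definition gaussian_gd_setting (R : realType) (c_m c_M : R) (p : nat -> nat)
    (d : nat -> measure_display) (Omega : forall n, measurableType (d n))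
    (P : forall n, probability (Omega n) R)
    (Sigma : forall n, 'M[R]_(p n))
    (X : forall n, Omega n -> 'M[R]_(n, p n))
    (b theta0 : forall n, Omega n -> 'cV[R]_(p n)) : Prop :=
  [/\ forall n, (0 < n)%N -> (0 < p n)%N,
      (c_m%:E <= ereal_inf
         [set (lambda_min (Sigma n))%:E | n in [set n | (0 < n)%N]])%E /\
      (ereal_sup [set (lambda_max (Sigma n))%:E | n in [set n | (0 < n)%N]]
         <= c_M%:E)%E,
      forall n, (0 < n)%N -> iid_gaussian_rows (P n) (Sigma n) (X n),
      forall n, (0 < n)%N -> {ae P n, forall w, col_range (X n w)^T (b n w)} &
      forall n, (0 < n)%N ->
        {ae P n, forall w, col_range (sample_cov (X n w)) (theta0 n w)}].

(* Main.v *)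
From HB Require Import structures.
Require Import Defs.
From mathcomp Require Import all_boot all_order all_algebra.
From mathcomp Require Import all_classical all_reals all_analysis.
From mathcomp Require Import measurable_realfun.
From mathcomp Require Import ring lra zify complex.
Import Order.TTheory GRing.Theory Num.Theory.
Import numFieldNormedType.Exports.

(** For the quadratic objective the gap to the optimum is
    [|X (theta - theta_opt)|^2 / 2n], because [S theta_opt = b]. A step of
    gradient descent applies [1 - S / lambda_max S] to the error
    [e = theta - theta_opt]. In the spectral decomposition of [e] along
    [X^T X], the zero eigenvalues do not contribute to [|X e|^2], and every
    other eigenvalue is at least [s_min^2], so that [|X e|^2] shrinks by the
    factor [1 - 1 / kappa^2] ([gd_step]). Since [1 - y <= exp (- y)], the
    integer part of [kappa^2 ln (1 / eps)] plus one steps are enough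
    ([iteration_complexity_le]); this requires [s_min > 0] only.

    What remains concerns the random matrix. Let [M] be the tall one of [X] and
    [X^T], of size [N * m] with [m <= N]. Everything is deduced from two
    estimates, with [c], [C] the bounds on the spectrum of Sigma:

      [E cos (h^T M u) <= exp (- c |h|^2 |u|^2 / 2)] and
      [E exp (h^T M u) <= exp (C |h|^2 |u|^2 / 2)]

    ([gaussian_like]). They are symmetric in [h] and [u], hence insensitive to
    transposition, so that wide and tall data need a single argument. Averaging
    the first one over a Gaussian [h] bounds the Laplace transform of
    [|M u|^2] ([integral_expR_Nsqr_le]), whence the small ball estimate
    [P (|M u|^2 <= N rho^2) <= (const rho)^N] for a fixed unit vector [u]
    ([small_ball]); the second one gives exponential tails for bilinear forms
    ([bilinear_tail]).

    Full rank almost surely ([gaussian_like_injective]): a kernel vector of [M],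
    normalised so that its largest coordinate is 1, is close to one of about
    [B^(m-1)] points of a grid of step [1/B], each of which is almost in the
    kernel with probability [O (B^-N)]; as [N >= m], the union bound is
    [O (1/B)].

    Moments of the condition number ([condition_mean]): if
    [kappa^2 >= x^(2q)], then either the largest singular value is at least
    [x sqrt N], which a net of fixed mesh excludes up to probability [x^-N], or
    the smallest one is at most [x^(1-q) sqrt N]. A net of mesh [x^-q] has
    [(const x^q)^m] points, and each of them is contracted that much with
    probability [(const x^(1-q))^N]; the product is at most [x^-N] for large [x]
    as soon as [3 N <= q (N - m)]. Summing [x^(2q) x^-N] over dyadic [x] bounds
    [E kappa^2] uniformly in the dimensions when [N > 2 q]. When [p / n] tends
    to [gamma <> 1], the difference [N - m] is at least a fixed proportion of
    [N], so that some [q] depending only on [gamma] is eventually admissible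
    ([aspect_ratio]). *)

Set Implicit Arguments.
Unset Strict Implicit.
Unset Printing Implicit Defensive.

Local Open Scope classical_set_scope.
Local Open Scope ring_scope.

(** * Transfer of integrals between laws *)

Section weighted_integral.
Context d1 d (T1 : measurableType d1) (T : measurableType d) (R : realType).
Variables (m : {measure set T1 -> \bar R}) (y : T1 -> T) (w : T1 -> R).
Hypotheses (my : measurable_fun setT y) (mw : measurable_fun setT w).
Hypothesis w0 : forall x, 0 <= w x.
Local Open Scope ereal_scope.
Import HBNNSimple.

(** The right-hand side sees [y] and the weight [w] only through integrals of
    indicators, so two such pairs that agree on indicators have equal integrals. *)
Lemma weighted_integral_approx (f : T -> \bar R) (mf : measurable_fun setT f) :
  (forall x, 0 <= f x) ->
  \int[m]_x (f (y x) * (w x)%:E) =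
  limn (fun n => \sum_(k \in range (nnsfun_approx measurableT mf n))
    (k%:E * \int[m]_x (\1_(nnsfun_approx measurableT mf n @^-1` [set k])
                          (y x) * w x)%:E)).
Proof.
move=> f0; pose f_ := nnsfun_approx measurableT mf.
have mfy n : measurable_fun setT (fun x => f_ n (y x)).
  exact: measurableT_comp.
have mi n k : measurable_fun setT
    (fun x => \1_(f_ n @^-1` [set k]) (y x) : R).
  by apply: (measurableT_comp _ my).
transitivity (limn (fun n => \int[m]_x (f_ n (y x) * w x)%:E)).
  rewrite -monotone_convergence//.
  - apply: eq_integral => x _; apply/esym/cvg_lim => //.
    under eq_fun do rewrite EFinM.
    apply: cvgeZr => //.
    exact: (cvg_nnsfun_approx measurableT mf (fun x _ => f0 x) (x := y x)).
  - by move=> n; apply/measurable_EFinP/measurable_funM.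
  - by move=> n x _; rewrite lee_fin mulr_ge0.
  - move=> x _ n k nk; rewrite lee_fin ler_wpM2r//.
    exact/lefP/nd_nnsfun_approx.
congr (limn _); apply/funext => n.
transitivity (\int[m]_x \sum_(k \in range (f_ n))
    (k%:E * (\1_(f_ n @^-1` [set k]) (y x) * w x)%:E)).
  apply: eq_integral => x _; rewrite [f_ n (y x)]fimfunE EFinM -fsumEFin//.
  rewrite ge0_mule_fsuml; last by move=> k; rewrite nnfun_muleindic_ge0.
  by apply: eq_fsbigr => k _; rewrite EFinM -muleA EFinM.
rewrite ge0_integral_fsum//.
- apply: eq_fsbigr => k /[!inE] -[x _ <-].
  rewrite ge0_integralZl_EFin//.
  + by move=> z _; rewrite lee_fin mulr_ge0.
  + by apply/measurable_EFinP/measurable_funM.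
- by move=> k; apply/measurable_EFinP/measurable_funM => //; exact: measurable_funM.
- by move=> k x _; rewrite -EFinM mulrA EFinM mule_ge0 ?lee_fin// -lee_fin nnfun_muleindic_ge0.
Qed.

End weighted_integral.

Section transfer.
Context d1 d2 d (T1 : measurableType d1) (T2 : measurableType d2)
  (T : measurableType d) (R : realType).
Variables (m1 : {measure set T1 -> \bar R}) (y1 : T1 -> T) (w1 : T1 -> R).
Variables (m2 : {measure set T2 -> \bar R}) (y2 : T2 -> T) (w2 : T2 -> R).
Hypotheses (my1 : measurable_fun setT y1) (mw1 : measurable_fun setT w1).
Hypotheses (my2 : measurable_fun setT y2) (mw2 : measurable_fun setT w2).
Hypotheses (w10 : forall x, 0 <= w1 x) (w20 : forall x, 0 <= w2 x).
Hypothesis w12 : forall B, measurable B ->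
  (\int[m1]_x (\1_B (y1 x) * w1 x)%:E = \int[m2]_x (\1_B (y2 x) * w2 x)%:E)%E.

Import HBNNSimple.

(** The weights let one statement cover a density ([w1 = 1], [w2] the density),
    an equality of laws ([w1 = w2 = 1]) and a factorisation of [E (f y * W)] ([w2]
    constant). *)
Lemma ge0_integral_transfer (f : T -> \bar R) : measurable_fun setT f ->
  (forall x, 0 <= f x)%E ->
  (\int[m1]_x (f (y1 x) * (w1 x)%:E) = \int[m2]_x (f (y2 x) * (w2 x)%:E))%E.
Proof.
move=> mf f0; rewrite !(weighted_integral_approx _ _ _ _ mf)//.
apply: congr_lim; apply/funext => n; apply: eq_fsbigr => k _.
by rewrite w12//; exact: measurable_funPTI.
Qed.

Hypothesis iw1 : m1.-integrable setT (EFin \o w1).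
Hypothesis iw2 : m2.-integrable setT (EFin \o w2).

(** Adding a constant makes a bounded function nonnegative. *)
Lemma Rintegral_transfer (f : T -> R) (M : R) : measurable_fun setT f ->
  (forall x, `|f x| <= M) ->
  \int[m1]_x (f (y1 x) * w1 x) = \int[m2]_x (f (y2 x) * w2 x).
Proof.
move=> mf fM.
have w12T : (\int[m1]_x (w1 x)%:E = \int[m2]_x (w2 x)%:E)%E.
  have := w12 measurableT.
  by under eq_integral do rewrite indicT mul1r;
     under [in X in _ = X -> _]eq_integral do rewrite indicT mul1r.
have key d0 (T0 : measurableType d0) (m : {measure set T0 -> \bar R})
      (y : T0 -> T) (w : T0 -> R) :
    measurable_fun setT y -> measurable_fun setT w -> (forall x, 0 <= w x) ->
    m.-integrable setT (EFin \o w) ->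
  (\int[m]_x (f (y x) * w x)%:E =
   \int[m]_x ((f (y x) + M)%:E * (w x)%:E) - M%:E * \int[m]_x (w x)%:E)%E.
  move=> my mw w0 iw.
  have ifw : m.-integrable setT (EFin \o (fun x => f (y x) * w x)).
    apply: (@le_integrable _ _ _ _ _ _ _ (fun x => (M * w x)%:E)) => //.
    - apply/measurable_EFinP/measurable_funM => //.
      exact: measurableT_comp.
    - move=> x _ /=; rewrite lee_fin !normrM ler_pM//.
      exact: le_trans (ler_norm _).
    - by under eq_fun do rewrite EFinM; exact: integrableZl.
  rewrite -integralZl//.
  transitivity (\int[m]_x ((f (y x) * w x)%:E + M%:E * (w x)%:E)
     - \int[m]_x (M%:E * (w x)%:E))%E; last first.
    by congr (_ - _)%E; apply: eq_integral => x _; rewrite EFinD -!EFinM -EFinD mulrDl.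
  rewrite integralD//; last exact: integrableZl.
  rewrite addeK//; apply: integrable_fin_num => //; exact: integrableZl.
rewrite /Rintegral !key// w12T; congr (fine (_ - _)%E).
apply: (ge0_integral_transfer (f := fun x => (f x + M)%:E)).
  by apply/measurable_EFinP; exact: measurable_funD.
by move=> x; rewrite lee_fin -lerBlDr sub0r; have := fM x; rewrite ler_norml => /andP[].
Qed.

End transfer.

(** * The standard normal distribution *)

Section bounded.
Context d (Omega : measurableType d) (R : realType).
Variable P : probability Omega R.

Lemma bounded_integrable (f : Omega -> R) M :
  measurable_fun setT f -> (forall x, `|f x| <= M) ->
  P.-integrable setT (EFin \o f).
Proof.
move=> mf fM.
have ic := finite_measure_integrable_cst P M measurableT.
apply: le_integrable ic => //; first exact/measurable_EFinP.
by move=> x _ /=; rewrite lee_fin (le_trans (fM x))// ler_norm.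
Qed.

Lemma EFin_Rintegral (f : Omega -> R) : P.-integrable setT (EFin \o f) ->
  (\int[P]_x (f x)%:E)%E = (\int[P]_x f x)%:E.
Proof. by move=> fi; rewrite /Rintegral fineK//; exact: integrable_fin_num. Qed.

End bounded.

Section normal_integrals.
Context {R : realType}.
Local Notation mu := (@lebesgue_measure R).
Local Notation N := (normal_prob (0 : R) 1).
Implicit Types (a s t x : R).

Lemma normal_pdfE1 t x :
  normal_pdf t 1 x = normal_peak 1 * expR (- ((x - t) ^+ 2 / 2)).
Proof. by rewrite normal_pdfE ?oner_eq0// /normal_fun expr1n mulNr. Qed.

Let transfer_pdf m s B : measurable B ->
  (\int[normal_prob m s]_x (\1_B (idfun x) * cst 1 x)%:E =
   \int[mu]_x (\1_B (idfun x) * normal_pdf m s x)%:E)%E.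
Proof.
move=> mB; under eq_integral do rewrite mulr1.
rewrite integral_indic// setIT [LHS]integral_mkcond.
apply: eq_integral => x _; rewrite patchE indicE.
by case: ifPn => _; rewrite ?mul1r ?mul0r.
Qed.

Lemma ge0_integral_normal_prob m s (f : R -> \bar R) :
  measurable_fun setT f -> (forall x, 0 <= f x)%E ->
  (\int[normal_prob m s]_x f x = \int[mu]_x (f x * (normal_pdf m s x)%:E))%E.
Proof.
move=> mf f0.
transitivity (\int[normal_prob m s]_x (f (idfun x) * (cst 1 x)%:E))%E.
  by apply: eq_integral => x _; rewrite mule1.
rewrite (ge0_integral_transfer (m2 := mu) (y2 := idfun) (w2 := normal_pdf m s))//.
- exact: measurable_id.
- exact: measurable_id.
- exact: measurable_normal_pdf.
- exact: normal_pdf_ge0.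
- exact: transfer_pdf.
Qed.

Lemma Rintegral_normal_prob m s (f : R -> R) M :
  measurable_fun setT f -> (forall x, `|f x| <= M) ->
  \int[normal_prob m s]_x f x = \int[mu]_x (f x * normal_pdf m s x).
Proof.
move=> mf fM.
transitivity (\int[normal_prob m s]_x (f (idfun x) * cst 1 x)).
  by apply: eq_Rintegral => x _; rewrite mulr1.
rewrite (Rintegral_transfer (m2 := mu) (y2 := idfun) (w2 := normal_pdf m s)
  _ _ _ _ _ _ _ _ _ mf fM)//.
- exact: measurable_id.
- exact: measurable_id.
- exact: measurable_normal_pdf.
- exact: normal_pdf_ge0.
- exact: transfer_pdf.
- exact: finite_measure_integrable_cst.
- exact: integrable_normal_pdf.
Qed.

(** Completing the square turns the integrand into a multiple of the density of
    mean [t]. *)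
Lemma normal_expR t : (\int[N]_x (expR (t * x))%:E = (expR (t ^+ 2 / 2))%:E)%E.
Proof.
rewrite ge0_integral_normal_prob//; last first.
  by apply/measurable_EFinP; apply: measurableT_comp => //; exact: measurable_funM.
transitivity (\int[mu]_x ((expR (t ^+ 2 / 2))%:E * (normal_pdf t 1 x)%:E))%E.
  apply: eq_integral => x _; rewrite -!EFinM !normal_pdfE1; congr EFin.
  rewrite mulrCA [RHS]mulrCA -!expRD; congr (_ * expR _).
  by field.
rewrite ge0_integralZl_EFin ?expR_ge0//; last 2 first.
  by move=> x _; rewrite lee_fin normal_pdf_ge0.
  by apply/measurable_EFinP; exact: measurable_normal_pdf.
by rewrite integral_normal_pdf mule1.
Qed.

(** The integrand is a multiple of the centred density of variance
    [1 / (1 + 2 a)]. *)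
Lemma normal_expR_Nsqr a : 0 <= a ->
  (\int[N]_x (expR (- (a * x ^+ 2)))%:E = (Num.sqrt (1 + 2 * a))^-1%:E)%E.
Proof.
move=> a0; have b0 : 0 < 1 + 2 * a by lra.
rewrite ge0_integral_normal_prob//; last first.
  apply/measurable_EFinP; apply: measurableT_comp => //.
  by apply: measurableT_comp => //; exact: measurable_funM.
set c := (Num.sqrt (1 + 2 * a))^-1.
have c0 : 0 < c by rewrite invr_gt0 sqrtr_gt0.
have cE : c ^+ 2 = (1 + 2 * a)^-1 by rewrite exprVn sqr_sqrtr// ltW.
transitivity (\int[mu]_x (c%:E * (normal_pdf 0 c x)%:E))%E.
  apply: eq_integral => x _; rewrite -!EFinM normal_pdfE1; congr EFin.
  rewrite normal_pdfE ?gt_eqF// /normal_fun mulrCA [RHS]mulrA -expRD; congr (_ * expR _).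
    rewrite /normal_peak -!mulrnAr !(sqrtrM (pi *+ 2)) ?sqr_ge0// !sqrtr_sqr normr1 mul1r.
    by rewrite (gtr0_norm c0) invfM mulrA divff ?mul1r// gt_eqF.
  by rewrite cE; field; rewrite gt_eqF.
rewrite ge0_integralZl_EFin ?(ltW c0)//; last 2 first.
  by move=> x _; rewrite lee_fin normal_pdf_ge0.
  by apply/measurable_EFinP; exact: measurable_normal_pdf.
by rewrite integral_normal_pdf mule1.
Qed.

Lemma integrable_normal_expR t :
  (normal_prob 0 1).-integrable setT (fun x => (expR (t * x))%:E).
Proof.
apply/integrableP; split.
  by apply/measurable_EFinP; apply: measurableT_comp => //; exact: measurable_funM.
under eq_integral do rewrite gee0_abs ?lee_fin ?expR_ge0//.
by rewrite normal_expR ltry.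
Qed.

Lemma integrable_normal_norm : (normal_prob 0 1).-integrable setT (fun x => `|x|%:E).
Proof.
have ie := integrableD measurableT (integrable_normal_expR 1)
  (integrable_normal_expR (-1)).
apply: le_integrable ie => //.
- by apply/measurable_EFinP; exact: normr_measurable.
- move=> x _; rewrite -EFinD abse_EFin abse_EFin lee_fin normr_id mul1r mulN1r.
  rewrite [leRHS]ger0_norm ?addr_ge0 ?expR_ge0// ler_norml.
  have := expR_ge1Dx x; have := expR_ge1Dx (- x).
  by have := expR_ge0 x; have := expR_ge0 (- x); lra.
Qed.

Lemma is_derive_normal_pdf x :
  is_derive x 1 (normal_pdf (0 : R) 1) (- x * normal_pdf 0 1 x).
Proof.
rewrite (_ : normal_pdf 0 1 = fun x => normal_peak 1 * expR (- (x ^+ 2 / 2))); last first.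
  by apply/funext => y; rewrite normal_pdfE1 subr0.
by apply: is_derive_eq; rewrite /GRing.scale/=; field.
Qed.

(** Against the normal density the integrand is the derivative of
    [- pdf x * sin (t x + c)], which vanishes at both infinities. *)
Lemma normal_stein t c :
  \int[N]_x (x * sin (t * x + c) - t * cos (t * x + c)) = 0.
Proof.
pose h x : R := x * sin (t * x + c) - t * cos (t * x + c).
pose G x : R := - (normal_pdf 0 1 x * sin (t * x + c)).
have ctx : continuous (fun x => t * x + c).
  by move=> x; apply: cvgD; [exact: mulrl_continuous|exact: cvg_cst].
have ch : continuous h.
  move=> x; apply: cvgB; apply: cvgM.
  - exact: cvg_id.
  - exact: (continuous_comp (ctx x) (@continuous_sin _ _)).
  - exact: cvg_cst.
  - exact: (continuous_comp (ctx x) (@continuous_cos _ _)).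
have mh : measurable_fun setT h by exact: continuous_measurable_fun.
have dG x : is_derive x 1 G (h x * normal_pdf 0 1 x).
  have := is_derive_normal_pdf x => ?.
  by apply: is_derive_eq; rewrite /GRing.scale/= /h; ring.
pose hn n x : R := h x * \1_`[- n.+1%:R, n.+1%:R] x.
have mhn n : measurable_fun setT (hn n).
  by apply: measurable_funM.
have hb x : `|h x| <= `|x| + `|t|.
  rewrite (le_trans (ler_normB _ _))// !normrM lerD// ler_piMr//.
    by rewrite ler_norml sin_geN1 sin_le1.
  by rewrite ler_norml cos_geN1 cos_le1.
have hnE n : \int[N]_x hn n x = G n.+1%:R - G (- n.+1%:R).
  rewrite (@Rintegral_normal_prob _ _ _ (n.+1%:R + `|t|))//; last first.
    move=> x; rewrite /hn indicE; case: (boolP (x \in _)) => [|_]; last first.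
      by rewrite mulr0 normr0 addr_ge0.
    rewrite inE/= in_itv/= -ler_norml mulr1 => xn.
    by rewrite (le_trans (hb x))// lerD2r.
  transitivity (fine (\int[mu]_(x in `[(- n.+1%:R : R), n.+1%:R]) (h x * normal_pdf 0 1 x)%:E)).
    rewrite /Rintegral; congr fine; rewrite [RHS]integral_mkcond.
    apply: eq_integral => x _; rewrite patchE /hn indicE.
    by case: (boolP (x \in _)) => _; rewrite ?mulr1 ?mulr0 ?mul0r.
  rewrite (@continuous_FTC2 _ _ G)//.
  - by rewrite gtrN.
  - apply: continuous_subspaceT => x; apply: cvgM; first exact: ch.
    by apply: continuous_normal_pdf; exact: oner_neq0.
  - have cG x : {for x, continuous G}.
      by apply/differentiable_continuous/derivable1_diffP; case: (dG x).
    split.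
    + by move=> x _; case: (dG x).
    + exact/cvg_at_right_filter/cG.
    + exact/cvg_at_left_filter/cG.
  - by move=> x _; rewrite derive1E; apply: derive_val.
(* The boundary terms decay like [1 / n], since [pdf x <= pdf 0 / x]. *)
have lim0 : \int[N]_x hn n x @[n --> \oo] --> (0 : R).
  apply: norm_cvg0.
  apply: (@squeeze_cvgr _ _ _ _ (cst 0) (fun n => (2 * normal_peak 1) * harmonic n)).
  - apply: nearW => n; rewrite normr_ge0/= hnE /harmonic/=.
    have Gn x : n.+1%:R <= `|x| -> `|G x| <= normal_peak 1 * n.+1%:R^-1.
      move=> nx; rewrite normrN normrM ger0_norm ?normal_pdf_ge0//.
      apply: (@le_trans _ _ (normal_pdf 0 1 x)).
        by rewrite ler_piMr ?normal_pdf_ge0// ler_norml sin_geN1 sin_le1.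
      rewrite normal_pdfE1 subr0 ler_wpM2l ?normal_peak_ge0// expRN.
      rewrite lef_pV2 ?posrE ?expR_gt0// (le_trans _ (expR_ge1Dx _))//.
      rewrite (le_trans nx)// -(real_normK (num_real x)).
      by have := sqr_ge0 (`|x| - 1); rewrite sqrrB1; lra.
    rewrite (le_trans (ler_normB _ _))// -mulrA mulr_natl mulr2n lerD// Gn//.
      by rewrite normr_nat.
    by rewrite normrN normr_nat.
  - exact: cvg_cst.
  - rewrite -(mulr0 (2 * normal_peak 1)).
    by apply: cvgM; [exact: cvg_cst|exact: cvg_harmonic].
have limh : \int[N]_x hn n x @[n --> \oo] --> \int[N]_x h x.
  apply: fine_cvg.
  have ih : N.-integrable setT (EFin \o h).
    have ig := integrableD measurableT integrable_normal_norm
      (finite_measure_integrable_cst N `|t| measurableT).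
    apply: le_integrable ig => //; first exact/measurable_EFinP.
    move=> x _; rewrite /= lee_fin [leRHS]ger0_norm; last first.
      by rewrite addr_ge0.
    exact: hb.
  rewrite fineK; last exact: integrable_fin_num.
  apply: (@dominated_cvg _ _ _ N setT measurableT _ _ (fun x => `|(h x)%:E|%E)) => //.
  - by move=> n; apply/measurable_EFinP; exact: (mhn n).
  - move=> x _; apply: cvg_near_cst.
    near=> n; rewrite /hn indicE mem_set ?mulr1//= in_itv/= -ler_norml.
    rewrite (@le_trans _ _ n%:R) ?ler_nat//.
    by near: n; exact: nbhs_infty_ger.
  - exact: integrable_abse.
  - move=> n x _; rewrite lee_fin /hn indicE.
    by case: (boolP (x \in _)) => _; rewrite ?mulr1 ?mulr0 ?normr0.
exact: (cvg_unique _ limh lim0).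
Unshelve. all: by end_near. Qed.

(** As a function [F] of [t] the integral satisfies [F' = - t F], by derivation
    under the integral sign and [normal_stein]. The phase [c] covers the real and the
    imaginary part of the characteristic function at once, and absorbs the further
    terms of a sum. *)
Lemma normal_cos t c :
  \int[N]_x cos (t * x + c) = expR (- (t ^+ 2 / 2)) * cos c.
Proof.
have ctx s : continuous (fun x => s * x + c).
  by move=> x; apply: cvgD; [exact: mulrl_continuous|exact: cvg_cst].
pose F t := \int[N]_x cos (t * x + c).
have mcos s : measurable_fun setT (fun x : R => cos (s * x + c)).
  apply: continuous_measurable_fun => x.
  exact: (continuous_comp (ctx s x) (@continuous_cos _ _)).
have msin s : measurable_fun setT (fun x : R => sin (s * x + c)).
  apply: continuous_measurable_fun => x.
  exact: (continuous_comp (ctx s x) (@continuous_sin _ _)).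
have icos s : N.-integrable setT (EFin \o (fun x : R => cos (s * x + c))).
  apply: (@bounded_integrable _ _ _ _ _ 1) => [|x]; first exact: mcos.
  by rewrite ler_norml cos_geN1 cos_le1.
have dcos s x : is_derive s 1 (fun s : R => cos (s * x + c)) (- (x * sin (s * x + c))).
  by apply: is_derive_eq; rewrite /GRing.scale/=; ring.
have ixsin s : N.-integrable setT (EFin \o (fun x : R => x * sin (s * x + c))).
  apply: le_integrable integrable_normal_norm => //.
    by apply/measurable_EFinP; apply: measurable_funM => //; exact: msin.
  move=> x _ /=; rewrite lee_fin normrM normr_id ler_piMr//.
  by rewrite ler_norml sin_geN1 sin_le1.
have dF s : is_derive s 1 F (- (s * F s)).
  have s1 : `](s - 1), (s + 1)[%classic s by rewrite /= in_itv/= !ltrBlDr ltrDl ltr01.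
  have d1 x y : derivable ((fun s x => cos (s * x + c)) ^~ y) x 1.
    exact: (@ex_derive _ _ _ _ _ _ _ (dcos x y)).
  have pE x y : partial1of2 (fun s x : R => cos (s * x + c)) x y = - (y * sin (x * y + c)).
    by rewrite partial1of2E; apply: derive_val.
  have ub x y : `](s - 1), (s + 1)[%classic x -> setT y ->
      `|partial1of2 (fun s x : R => cos (s * x + c)) x y| <= `|y|.
    move=> _ _; rewrite pE normrN normrM ler_piMr//.
    by rewrite ler_norml sin_geN1 sin_le1.
  have D := @derivable_under_integral _ _ _ N _ setT measurableT s _ _ s1
    (fun x _ => icos x) (fun x y _ _ => d1 x y) _ (fun y => normr_ge0 y)
    integrable_normal_norm ub.
  apply: DeriveDef; first exact: D.
  rewrite -derive1E (@differentiation_under_integral _ _ _ N _ setT measurableT s _ _ s1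
    (fun x _ => icos x) (fun x y _ _ => d1 x y) _ (fun y => normr_ge0 y)
    integrable_normal_norm ub).
  under eq_Rintegral do rewrite pE.
  have := normal_stein s c; rewrite RintegralB//; last first.
    exact: (integrableZl measurableT s (icos s)).
  rewrite RintegralZl// => /eqP; rewrite subr_eq0 => /eqP sE.
  under eq_Rintegral do rewrite -mulN1r.
  by rewrite RintegralZl// sE mulN1r.
have dG s : is_derive s 1 (fun s => F s * expR (s ^+ 2 / 2)) 0.
  have := dF s => ?.
  by apply: is_derive_eq; rewrite /GRing.scale/=; field.
have := is_derive_0_is_cst t 0 dG.
have -> : F 0 = cos c.
  rewrite /F; under eq_Rintegral do rewrite mul0r add0r.
  by rewrite Rintegral_cst// (_ : _ setT = 1%E) ?mulr1//; exact: probability_setT.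
rewrite expr0n/= mul0r expR0 mulr1 => <-.
by rewrite expRN mulrC mulfK// gt_eqF ?expR_gt0.
Qed.

End normal_integrals.

(** * Trigonometric and exponential moments of independent sums *)

Section independence.
Context d (Omega : measurableType d) (R : realType).
Variable P : probability Omega R.

Lemma Rintegral_indic_comp (y : Omega -> R) (B : set R) (r : R) :
  measurable_fun setT y -> measurable B ->
  \int[P]_w (\1_B (y w) * r) = r * fine (P (y @^-1` B)).
Proof.
move=> my mB; under eq_Rintegral do rewrite mulrC.
have mi : measurable_fun setT (fun w => \1_B (y w) : R).
  by apply: (measurableT_comp _ my).
rewrite RintegralZl//; last first.
  by apply: (@bounded_integrable _ _ _ _ _ 1) => // x; rewrite indicE normr_nat lern1 leq_b1.
congr (_ * _); rewrite /Rintegral (_ : (fun x => _) = (fun x => (\1_(y @^-1` B) x)%:E)).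
  by rewrite integral_indic ?setIT// -[X in measurable X]setTI; exact: my.
by apply/funext => x; rewrite !indicE; congr (_%:R%:E); rewrite !inE.
Qed.

(** The hypothesis says that [W] has constant conditional mean [c] given [y].
    Adding the bound [M] turns [W] into a nonnegative weight, to which the transfer
    lemma applies. *)
Lemma decouple (y W : Omega -> R) (c M L : R) (f : R -> R) :
  measurable_fun setT y -> measurable_fun setT W -> (forall w, `|W w| <= M) ->
  (forall B, measurable B ->
     \int[P]_w (\1_B (y w) * W w) = c * fine (P (y @^-1` B))) ->
  measurable_fun setT f -> (forall x, `|f x| <= L) ->
  \int[P]_w (f (y w) * W w) = c * \int[P]_w f (y w).
Proof.
move=> my mW WM cE mf fL.
have mfy : measurable_fun setT (f \o y) by exact: measurableT_comp.
have iW : P.-integrable setT (EFin \o W) by exact: bounded_integrable WM.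
have ifW : P.-integrable setT (EFin \o (fun w => f (y w) * W w)).
  apply: (@bounded_integrable _ _ _ _ _ (L * M)); first exact: measurable_funM.
  by move=> x; rewrite normrM ler_pM.
have ify : P.-integrable setT (EFin \o (f \o y)).
  by apply: (@bounded_integrable _ _ _ _ _ L) => // x /=.
have cW : c = \int[P]_w W w.
  have := cE _ measurableT; rewrite preimage_setT probability_setT mulr1 => <-.
  by apply: eq_Rintegral => w _; rewrite indicT mul1r.
have cM0 : 0 <= c + M.
  rewrite -lerBlDr sub0r cW.
  have <- : \int[P]_w (- M) = - M.
    by rewrite Rintegral_cst// (_ : _ setT = 1%E) ?mulr1//; exact: probability_setT.
  apply: le_Rintegral => //; first exact: finite_measure_integrable_cst.
  by move=> w _; have := WM w; rewrite ler_norml => /andP[].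
have miy B : measurable B -> measurable_fun setT (fun w => \1_B (y w) : R).
  by move=> mB; apply: (measurableT_comp _ my).
have iy1 B (r : R) : `|\1_B r| <= (1 : R) by rewrite indicE normr_nat lern1 leq_b1.
have idM (g : Omega -> R) K : measurable_fun setT g -> (forall x, `|g x| <= K) ->
    P.-integrable setT (EFin \o (fun w => g w * M)).
  move=> mg gK; apply: (@bounded_integrable _ _ _ _ _ (K * `|M|)).
    exact: measurable_funM.
  by move=> x; rewrite normrM ler_wpM2r.
have iyW B : measurable B -> P.-integrable setT (EFin \o (fun w => \1_B (y w) * W w)).
  move=> mB; apply: (@bounded_integrable _ _ _ _ _ M).
    by apply: measurable_funM => //; exact: miy.
  by move=> x; rewrite normrM -[M]mul1r ler_pM.
have : \int[P]_w (f (y w) * (W w + M)) = \int[P]_w (f (y w) * cst (c + M) w).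
  apply: (Rintegral_transfer (m1 := P) (m2 := P) (y1 := y) (y2 := y)
    (w1 := fun w => W w + M) (w2 := cst (c + M)) _ _ _ _ _ _ _ _ _ mf fL) => //.
  - exact: measurable_funD.
  - by move=> w; rewrite -lerBlDr sub0r; have := WM w; rewrite ler_norml => /andP[].
  - move=> B mB; have i1 := iyW B mB; have i2 := idM _ _ (miy B mB) (fun w => iy1 B (y w)).
    rewrite !EFin_Rintegral; last 2 first.
    + apply: (@bounded_integrable _ _ _ _ _ `|c + M|) => [|w].
        by apply: measurable_funM => //; exact: miy.
      by rewrite normrM -[leRHS]mul1r ler_wpM2r.
    + rewrite (_ : _ \o _ = (fun w => (\1_B (y w) * W w)%:E + (\1_B (y w) * M)%:E)%E).
        exact: integrableD.
      by apply/funext => w /=; rewrite mulrDr.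
    rewrite Rintegral_indic_comp//.
    under eq_Rintegral do rewrite mulrDr.
    by rewrite RintegralD// cE// Rintegral_indic_comp// -mulrDl.
  - exact: (integrableD measurableT iW (finite_measure_integrable_cst P M measurableT)).
  - exact: finite_measure_integrable_cst.
under eq_Rintegral do rewrite mulrDr.
rewrite RintegralD//; last by apply: (idM (f \o y) L) => // x /=.
rewrite !RintegralZr// => /eqP; rewrite mulrDr (inj_eq (addIr _)) => /eqP ->.
by rewrite mulrC.
Qed.

Lemma ge0_decouple (y W : Omega -> R) (c : R) (f : R -> \bar R) :
  measurable_fun setT y -> measurable_fun setT W -> (forall w, 0 <= W w) ->
  0 <= c ->
  (forall B, measurable B ->
     \int[P]_w (\1_B (y w) * W w)%:E = c%:E * P (y @^-1` B))%E ->
  measurable_fun setT f -> (forall x, 0 <= f x)%E ->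
  (\int[P]_w (f (y w) * (W w)%:E) = c%:E * \int[P]_w f (y w))%E.
Proof.
move=> my mW W0 c0 cE mf f0.
rewrite (ge0_integral_transfer (m2 := P) (y2 := y) (w2 := cst c) _ _ _ _ _ _ _ mf)//.
- under eq_integral do rewrite muleC.
  by rewrite ge0_integralZl_EFin//; exact: measurableT_comp.
- move=> B mB; rewrite cE//; under eq_integral do rewrite mulrC EFinM.
  have mi : measurable_fun setT (fun w => \1_B (y w) : R).
    by apply: (measurableT_comp _ my).
  rewrite ge0_integralZl_EFin//; last exact/measurable_EFinP.
  congr (_ * _)%E.
  rewrite (_ : (fun x => _) = (fun x => (\1_(y @^-1` B) x)%:E)).
    by rewrite integral_indic ?setIT// -[X in measurable X]setTI; exact: my.
  by apply/funext => x; rewrite !indicE; congr (_%:R%:E); rewrite !inE.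
Qed.

Definition independent_rvs (I : finType) (y : I -> Omega -> R) :=
  forall B : I -> set R, (forall i, measurable (B i)) ->
    P (\bigcap_(i in [set: I]) (y i @^-1` B i)) =
    (\prod_(i : I) P (y i @^-1` B i))%E.

Section sums.
Variables (I : finType) (y : I -> Omega -> R).
Hypothesis my : forall i, measurable_fun setT (y i).
Hypothesis iy : independent_rvs y.

(* In the inductions below the variables indexed by [s] are summed while the
   others are tested by indicators. *)
Let upd (B : I -> set R) i (A : set R) : I -> set R :=
  fun j => if j == i then A else B j.

Let pr (B : I -> set R) i := fine (P (y i @^-1` B i)).

Let ind (s : seq I) (B : I -> set R) w : R := \prod_(i | i \notin s) \1_(B i) (y i w).

Let mind s B : (forall i, measurable (B i)) -> measurable_fun setT (ind s B).
Proof.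
move=> mB; rewrite (_ : ind s B = fun w => \prod_i
  if i \notin s then \1_(B i) (y i w) else 1); last first.
  by apply/funext => w; rewrite /ind big_mkcond.
apply: measurable_prod => i _; case: (i \notin s) => //.
by apply: (measurableT_comp _ (my i)).
Qed.

Let ind_bound s B w : 0 <= ind s B w <= 1.
Proof.
rewrite prodr_ge0/=; last by move=> i _; rewrite indicE.
by apply: Num.Theory.prodr_ile1 => i _; rewrite indicE ler0n lern1 leq_b1.
Qed.

Let ind_nil B : (forall i, measurable (B i)) ->
  (\int[P]_w (ind [::] B w)%:E)%E = (\prod_i pr B i)%:E.
Proof.
move=> mB; transitivity (P (\bigcap_(i in [set: I]) (y i @^-1` B i))); last first.
  rewrite iy// -prodEFin; apply: eq_bigr => i _; rewrite fineK// fin_num_measure//.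
  by rewrite -[X in measurable X]setTI; exact: my.
rewrite -[X in P X]setIT -integral_indic//; last first.
  apply: fin_bigcap_measurable => // i _.
  by rewrite -[X in measurable X]setTI; exact: my.
apply: eq_integral => w _; congr EFin; rewrite indicE /ind.
have [wB|/negP wB] := boolP (w \in _).
  rewrite big1// => i _; rewrite indicE mem_set//.
  by move: wB; rewrite inE => /(_ i Logic.I).
have [i wi] : exists i, ~ B i (y i w).
  by apply/existsNP => yB; apply: wB; rewrite inE => i _; exact: yB.
by rewrite (bigD1 i)//= indicE memNset// mul0r.
Qed.

Let ind_upd s i A B w : i \notin s ->
  ind s (upd B i A) w = \1_A (y i w) * ind (i :: s) B w.
Proof.
move=> si; rewrite /ind (bigD1 i)//= /upd eqxx; congr (_ * _).
under [LHS]eq_bigl do rewrite andbC -negb_or -in_cons.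
by apply: eq_bigr => j; rewrite in_cons negb_or => /andP[/negbTE ->].
Qed.

Let pr_upd s i A B : i \notin s ->
  \prod_(j | j \notin s) pr (upd B i A) j =
  fine (P (y i @^-1` A)) * \prod_(j | j \notin i :: s) pr B j.
Proof.
move=> si; rewrite (bigD1 i)//= /pr /upd eqxx; congr (_ * _).
under [LHS]eq_bigl do rewrite andbC -negb_or -in_cons.
by apply: eq_bigr => j; rewrite in_cons negb_or => /andP[/negbTE ->].
Qed.

Let measurable_sum_seq s : measurable_fun setT (fun w => \sum_(i <- s) y i w).
Proof. by apply: measurable_sum. Qed.

Let mupd B i A : (forall i, measurable (B i)) -> measurable A ->
  forall j, measurable (upd B i A j).
Proof. by move=> mB mA j; rewrite /upd; case: ifP. Qed.

Section trig.
Variable c : I -> R.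
Hypothesis cy : forall i, \int[P]_w cos (y i w) = c i.
Hypothesis sy : forall i, \int[P]_w sin (y i w) = 0.

(** The addition formulas mix sine and cosine, hence the joint induction. The
    indicators of the variables outside [s] are what makes it work: at the step from
    [s] to [i :: s], the induction hypothesis with varying event for [y i] is the
    hypothesis of [decouple]. *)
Lemma integral_trig_sum_indic s : uniq s -> forall B, (forall i, measurable (B i)) ->
  \int[P]_w (cos (\sum_(i <- s) y i w) * ind s B w) =
    (\prod_(i <- s) c i) * \prod_(i | i \notin s) pr B i /\
  \int[P]_w (sin (\sum_(i <- s) y i w) * ind s B w) = 0.
Proof.
elim: s => [_ B mB|i s IH /= /andP[si us] B mB].
  split.
    rewrite big_nil mul1r -[RHS]/(fine (\prod_i pr B i)%:E) -(ind_nil mB).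
    by apply: eq_Rintegral => w _; rewrite big_nil cos0 mul1r.
  under eq_Rintegral do rewrite big_nil sin0 mul0r.
  by rewrite Rintegral_cst// mul0r.
pose S w := \sum_(j <- s) y j w.
pose V := ind (i :: s) B.
have mS : measurable_fun setT S by exact: measurable_sum_seq.
have mV : measurable_fun setT V by exact: mind.
pose p := \prod_(j | j \notin i :: s) pr B j.
have mc (f : Omega -> R) : measurable_fun setT f -> measurable_fun setT (fun w => cos (f w)).
  move=> mf; apply: measurableT_comp mf.
  exact: continuous_measurable_fun (@continuous_cos R).
have ms (f : Omega -> R) : measurable_fun setT f -> measurable_fun setT (fun w => sin (f w)).
  move=> mf; apply: measurableT_comp mf.
  exact: continuous_measurable_fun (@continuous_sin R).
have c1 (x : R) : `|cos x| <= 1 by rewrite ler_norml cos_geN1 cos_le1.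
have s1 (x : R) : `|sin x| <= 1 by rewrite ler_norml sin_geN1 sin_le1.
have V1 w : `|V w| <= 1.
  by have /andP[? ?] := ind_bound (i :: s) B w; rewrite ger0_norm.
have bd (f : Omega -> R) w : (forall w, `|f w| <= 1) -> `|f w * V w| <= 1.
  by move=> f1; rewrite normrM mulr_ile1.
have EC (f : R -> R) : measurable_fun setT f -> (forall x, `|f x| <= 1) ->
   \int[P]_w (f (y i w) * (cos (S w) * V w)) =
   (\prod_(j <- s) c j * p) * \int[P]_w f (y i w).
  move=> mf f1; apply: (decouple (M := 1) (L := 1)) => //.
  - by apply: measurable_funM => //; exact: mc.
  - by move=> w; exact: (bd (fun w => cos (S w))).
  - move=> A mA; rewrite -mulrA [p * _]mulrC -pr_upd//.
    have [<- _] := IH us (upd B i A) (mupd i mB mA).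
    by apply: eq_Rintegral => w _; rewrite ind_upd// mulrCA.
have ES (f : R -> R) : measurable_fun setT f -> (forall x, `|f x| <= 1) ->
   \int[P]_w (f (y i w) * (sin (S w) * V w)) = 0.
  move=> mf f1; rewrite -[RHS](mul0r (\int[P]_w f (y i w))).
  apply: (decouple (M := 1) (L := 1)) => //.
  - by apply: measurable_funM => //; exact: ms.
  - by move=> w; exact: (bd (fun w => sin (S w))).
  - move=> A mA; rewrite mul0r.
    have [_ <-] := IH us (upd B i A) (mupd i mB mA).
    by apply: eq_Rintegral => w _; rewrite ind_upd// mulrCA.
have mcos : measurable_fun setT (@cos R).
  exact: continuous_measurable_fun (@continuous_cos R).
have msin : measurable_fun setT (@sin R).
  exact: continuous_measurable_fun (@continuous_sin R).
have itg (f g : Omega -> R) : measurable_fun setT f -> measurable_fun setT g ->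
    (forall w, `|f w| <= 1) -> (forall w, `|g w| <= 1) ->
    P.-integrable setT (EFin \o (fun w => f w * (g w * V w))).
  move=> mf mg f1 g1; apply: (@bounded_integrable _ _ _ _ _ 1).
    by do 2 apply: measurable_funM => //.
  by move=> w; rewrite normrM mulr_ile1// bd.
split.
- transitivity (\int[P]_w (cos (y i w) * (cos (S w) * V w) -
                            sin (y i w) * (sin (S w) * V w))).
    by apply: eq_Rintegral => w _; rewrite big_cons cosD mulrBl !mulrA.
  rewrite RintegralB//; [|by apply: itg => //; [exact: mc|exact: mc] |
    by apply: itg => //; [exact: ms|exact: ms]].
  by rewrite EC// ES// cy subr0 big_cons mulrC mulrA.
- transitivity (\int[P]_w (sin (y i w) * (cos (S w) * V w) +
                            cos (y i w) * (sin (S w) * V w))).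
    by apply: eq_Rintegral => w _; rewrite big_cons sinD mulrDl !mulrA.
  rewrite RintegralD//; [|by apply: itg => //; [exact: ms|exact: mc] |
    by apply: itg => //; [exact: mc|exact: ms]].
  by rewrite EC// ES// sy mulr0 addr0.
Qed.

Lemma integral_cos_sum :
  \int[P]_w cos (\sum_i y i w) = \prod_i c i /\
  \int[P]_w sin (\sum_i y i w) = 0.
Proof.
have [] := integral_trig_sum_indic (index_enum_uniq I) (B := fun=> setT) (fun=> measurableT).
rewrite [X in _ * X]big1 ?mulr1; last by move=> i; rewrite mem_index_enum.
have indT w : ind (index_enum I) (fun=> setT) w = 1.
  by rewrite /ind big1// => i; rewrite mem_index_enum.
by under eq_Rintegral do rewrite indT mulr1; move=> ->;
   under eq_Rintegral do rewrite indT mulr1; move=> ->.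
Qed.

End trig.

Section exp.
Variable e : I -> R.
Hypothesis e0 : forall i, 0 <= e i.
Hypothesis ey : forall i, (\int[P]_w (expR (y i w))%:E = (e i)%:E)%E.

(** The induction of [integral_trig_sum_indic] with nonnegative extended-real
    integrals, as exponentials are unbounded. *)
Lemma integral_expR_sum_indic s : uniq s -> forall B, (forall i, measurable (B i)) ->
  (\int[P]_w (expR (\sum_(i <- s) y i w) * ind s B w)%:E =
    ((\prod_(i <- s) e i) * \prod_(i | i \notin s) pr B i)%:E)%E.
Proof.
elim: s => [_ B mB|i s IH /= /andP[si us] B mB].
  rewrite big_nil mul1r -[RHS]/(\prod_i pr B i)%:E -(ind_nil mB).
  by apply: eq_integral => w _; rewrite big_nil expR0 mul1r.
pose S w := \sum_(j <- s) y j w.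
pose V := ind (i :: s) B.
have mS : measurable_fun setT S by exact: measurable_sum_seq.
have mV : measurable_fun setT V by exact: mind.
pose p := \prod_(j | j \notin i :: s) pr B j.
have mE (f : Omega -> R) : measurable_fun setT f -> measurable_fun setT (fun w => expR (f w)).
  by move=> mf; apply: measurableT_comp mf.
transitivity (\int[P]_w ((expR (y i w))%:E * (expR (S w) * V w)%:E))%E.
  by apply: eq_integral => w _; rewrite big_cons expRD -mulrA EFinM.
have p0 : 0 <= p by apply: prodr_ge0 => j _; rewrite fine_ge0.
rewrite (ge0_decouple (c := \prod_(j <- s) e j * p) (f := fun x => (expR x)%:E))//.
- by rewrite ey -EFinM big_cons; congr EFin; rewrite mulrC mulrA.
- by apply: measurable_funM => //; exact: mE.
- by move=> w; rewrite mulr_ge0 ?expR_ge0//; case/andP: (ind_bound (i :: s) B w).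
- by rewrite mulr_ge0// prodr_ge0.
- move=> A mA.
  have mPA : (P (y i @^-1` A)) \is a fin_num.
    by rewrite fin_num_measure// -[X in measurable X]setTI; exact: my.
  rewrite -(fineK mPA) -EFinM -mulrA [p * _]mulrC -pr_upd//.
  have <- := IH us (upd B i A) (mupd i mB mA).
  by apply: eq_integral => w _; rewrite ind_upd// mulrCA.
- exact/measurable_EFinP.
Qed.

Lemma integral_expR_sum :
  (\int[P]_w (expR (\sum_i y i w))%:E = (\prod_i e i)%:E)%E.
Proof.
have := integral_expR_sum_indic (index_enum_uniq I) (B := fun=> setT) (fun=> measurableT).
rewrite [X in _ * X]big1 ?mulr1; last by move=> i; rewrite mem_index_enum.
have indT w : ind (index_enum I) (fun=> setT) w = 1.
  by rewrite /ind big1// => i; rewrite mem_index_enum.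
by under eq_integral do rewrite indT mulr1.
Qed.

End exp.
End sums.
End independence.

(** * Gaussian linearisation of a square *)

Section hubbard_stratonovich.
Context d (Omega : measurableType d) (R : realType).
Variable P : probability Omega R.
Let N : probability (measurableTypeR R) R := normal_prob (0 : R) 1.
Variables (I : finType) (y : I -> Omega -> R) (c s : R).
Hypothesis my : forall i, measurable_fun setT (y i).
Hypotheses (c0 : 0 <= c) (s0 : 0 <= s).
Hypothesis Ecos : forall h : I -> R,
  \int[P]_w cos (\sum_i h i * y i w) <= expR (- (c / 2 * \sum_i h i ^+ 2)).

Let A := (Num.sqrt (1 + 2 * (s * c)))^-1.

(** One square is removed at a time: [exp (- s y^2) = E cos (sqrt (2 s) g y)]
    for a standard normal [g], and with a phase the new cosine merges with the one
    already present. After exchanging the integrals, the coordinate [h i = 0] has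
    become [sqrt (2 s) g], and the average over [g] of [exp (- s c g^2)] is the
    factor [A]. *)
Lemma integral_expR_Nsqr_cos_le (r : seq I) : uniq r -> forall h : I -> R,
  (forall i, i \in r -> h i = 0) ->
  \int[P]_w (expR (- (s * \sum_(i <- r) y i w ^+ 2)) * cos (\sum_i h i * y i w))
  <= A ^+ size r * expR (- (c / 2 * \sum_i h i ^+ 2)).
Proof.
have A0 : 0 <= A by rewrite invr_ge0.
elim: r => [_ h _|i r IH /= /andP[ir ur] h h0].
  rewrite expr0 mul1r; apply: le_trans (Ecos h).
  by under eq_Rintegral do rewrite big_nil mulr0 oppr0 expR0 mul1r.
pose C w := \sum_i h i * y i w.
pose Q w := \sum_(i <- r) y i w ^+ 2.
have mC : measurable_fun setT C.
  by apply: measurable_sum => j; exact: measurable_funM.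
have mQ : measurable_fun setT Q.
  by apply: measurable_sum => j; exact: measurable_funX.
have Q0 w : 0 <= Q w by apply: sumr_ge0 => j _; rewrite sqr_ge0.
pose t := Num.sqrt (2 * s).
(* Integrating [K (w, g)] over [g] restores the factor [exp (- s (y i w)^2)]. *)
pose K (z : Omega * R) := expR (- (s * Q z.1)) * cos (t * y i z.1 * z.2 + C z.1).
have mcos : measurable_fun setT (@cos R).
  exact: continuous_measurable_fun (@continuous_cos R).
have mK : measurable_fun setT K.
  apply: measurable_funM.
    apply: measurableT_comp => //; apply: measurableT_comp => //.
    apply: measurable_funM => //; exact: measurableT_comp.
  apply: measurableT_comp => //; apply: measurable_funD; last exact: measurableT_comp.
  by apply: measurable_funM => //; apply: measurable_funM => //; exact: measurableT_comp.
have K1 z : `|K z| <= 1.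
  rewrite normrM mulr_ile1//.
    by rewrite ger0_norm ?expR_ge0// -expR0 ler_expR oppr_le0 mulr_ge0.
  by rewrite ler_norml cos_geN1 cos_le1.
have iK : (P \x N)%E.-integrable setT (EFin \o K).
  exact: (@bounded_integrable _ _ _ (P \x N)%E _ 1).
have K1i (m : probability Omega R) g : m.-integrable setT (EFin \o (fun w => K (w, g))).
  apply: (@bounded_integrable _ _ _ _ _ 1) => //.
  exact: (measurable_fun_pair1 g mK).
have K2i w : N.-integrable setT (EFin \o (fun g => K (w, g))).
  apply: (@bounded_integrable _ _ _ _ _ 1) => //.
  exact: (measurable_fun_pair2 w mK).
have E1 w : expR (- (s * \sum_(j <- i :: r) y j w ^+ 2)) * cos (C w) =
    \int[N]_g K (w, g).
  have t2 : t ^+ 2 = 2 * s by rewrite sqr_sqrtr// mulr_ge0.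
  transitivity (expR (- (s * Q w)) * \int[N]_g cos (t * y i w * g + C w)).
    rewrite normal_cos big_cons mulrA -expRD; congr (expR _ * _).
    by rewrite /Q exprMn t2; field.
  rewrite -RintegralZl//.
  have mt : measurable_fun setT (fun g : R => cos (t * y i w * g + C w)).
    by apply: measurableT_comp => //; exact: measurable_funD.
  apply: (@bounded_integrable _ _ _ _ _ 1) => [|x]; first exact: mt.
  by rewrite ler_norml cos_geN1 cos_le1.
under eq_Rintegral do rewrite -/(C _) E1.
have -> : \int[P]_w \int[N]_g K (w, g) = \int[N]_g \int[P]_w K (w, g).
  rewrite {1 3}/Rintegral; congr fine.
  under eq_integral => w _ do rewrite -(EFin_Rintegral (K2i w)).
  under [RHS]eq_integral => g _ do rewrite -(EFin_Rintegral (K1i P g)).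
  exact: (Fubini iK).
pose D := A ^+ size r * expR (- (c / 2 * \sum_i h i ^+ 2)).
have D0 : 0 <= D by rewrite mulr_ge0 ?expR_ge0// exprn_ge0.
have inner g : \int[P]_w K (w, g) <= D * expR (- (s * c * g ^+ 2)).
  pose h' j := if j == i then t * g else h j.
  have hi : h i = 0 by apply: h0; rewrite mem_head.
  have h'0 j : j \in r -> h' j = 0.
    move=> jr; rewrite /h'; case: eqP => [ji|_]; first by rewrite -ji jr in ir.
    by apply: h0; rewrite in_cons jr orbT.
  have := IH ur h' h'0.
  have h'E (F : I -> R -> R) : (forall j, F j 0 = 0) ->
      \sum_j F j (h' j) = F i (t * g) + \sum_j F j (h j).
    move=> F0; rewrite (bigD1 i)//= [in RHS](bigD1 i)//= hi F0 add0r /h' eqxx.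
    by congr (_ + _); apply: eq_bigr => j /negbTE ->.
  have -> : \sum_j h' j ^+ 2 = 2 * s * g ^+ 2 + \sum_j h j ^+ 2.
    rewrite (h'E (fun _ x => x ^+ 2)) => [|j]; last by rewrite expr0n.
    by rewrite exprMn sqr_sqrtr// mulr_ge0.
  have -> : \int[P]_w (expR (- (s * \sum_(j <- r) y j w ^+ 2)) *
     cos (\sum_j h' j * y j w)) = \int[P]_w K (w, g).
    apply: eq_Rintegral => w _; rewrite (h'E (fun j x => x * y j w)) => [|j]; last first.
      by rewrite mul0r.
    by rewrite /K/= mulrAC.
  move=> /le_trans; apply; rewrite /D -[leRHS]mulrA -expRD ler_wpM2l ?exprn_ge0//.
  by rewrite ler_expR le_eqVlt; apply/orP; left; apply/eqP; field.
have iexp : N.-integrable setT (fun g : R => (expR (- (s * c * g ^+ 2)))%:E).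
  apply: (@bounded_integrable _ _ _ _ _ 1) => [|g].
    apply: measurableT_comp => //; apply: measurableT_comp => //.
    exact: measurable_funM.
  by rewrite ger0_norm ?expR_ge0// -expR0 ler_expR oppr_le0 mulr_ge0 ?sqr_ge0// mulr_ge0.
apply: (@le_trans _ _ (\int[N]_g (D * expR (- (s * c * g ^+ 2))))).
  apply: le_Rintegral => //.
  - apply: (@bounded_integrable _ _ _ _ _ 1) => [|g].
      apply/measurable_EFinP.
      rewrite (_ : _ \o _ = fubini_G P (EFin \o K)); first exact: (measurable_fubini_G iK).
      by apply/funext => g; rewrite /fubini_G/= -(EFin_Rintegral (K1i P g)).
    rewrite (le_trans (le_normr_Rintegral _ (K1i P g)))//.
    apply: (@le_trans _ _ (\int[P]_w 1)); last first.
      by rewrite Rintegral_cst// (_ : _ setT = 1%E) ?mulr1//; exact: probability_setT.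
    apply: le_Rintegral => //.
      exact: (integrable_abse (K1i P g)).
    exact: finite_measure_integrable_cst.
  - exact: (integrableZl measurableT D iexp).
rewrite RintegralZl// {1}/Rintegral normal_expR_Nsqr ?mulr_ge0//= /D.
by rewrite -/A exprS mulrAC [A ^+ _ * A]mulrC.
Qed.

Lemma integral_expR_Nsqr_le :
  \int[P]_w expR (- (s * \sum_i y i w ^+ 2)) <= A ^+ #|I|.
Proof.
have := integral_expR_Nsqr_cos_le (index_enum_uniq I) (h := fun=> 0) (fun _ _ => erefl).
have sz : size (index_enum I) = #|I| by rewrite cardT enumT.
rewrite [X in expR (- (_ * X))]big1 ?mulr0 ?oppr0 ?expR0 ?mulr1; last first.
  by move=> i _; rewrite expr0n.
rewrite sz; congr (_ <= _); apply: eq_Rintegral => w _.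
by rewrite [X in cos X]big1 ?cos0 ?mulr1// => j _; rewrite mul0r.
Qed.

End hubbard_stratonovich.

(** * Linear images of Gaussian vectors *)

Section gaussian_vectors.
Context d (Omega : measurableType d) (R : realType).
Variable P : probability Omega R.

(** The sigma-algebra generated by [x] is put on [Omega] as its measurable
    structure; linear combinations of the coordinates are then measurable by the
    general lemmas. *)
Lemma sigma_of_linear (k : nat) (x : Omega -> 'cV[R]_k) (a : 'I_k -> R)
    (B : set R) : measurable B ->
  sigma_of x ((fun w => \sum_j a j * x w j 0) @^-1` B).
Proof.
move=> mB.
pose G := \big[setU/set0]_(i < k)
  preimage_set_system setT (fun w => x w i 0) (@measurable _ R).
pose T := g_sigma_algebraType G.
have mx j : measurable_fun setT (fun w : T => x w j 0).
  move=> _ C mC; rewrite setTI; apply: sub_sigma_algebra.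
  rewrite /G (bigD1 j)//=; left.
  by exists C => //; rewrite setTI.
have : measurable_fun setT (fun w : T => \sum_j a j * x w j 0).
  by apply: measurable_sum => j; exact: measurable_funM.
by move=> /(_ measurableT B mB); rewrite setTI.
Qed.

Lemma independent_linear (I : finType) (k : I -> nat)
    (x : forall i, Omega -> 'cV[R]_(k i)) (a : forall i, 'I_(k i) -> R) :
  mutually_independent P (fun i => sigma_of (x i)) ->
  independent_rvs P (fun i w => \sum_j a i j * x i w j 0).
Proof.
move=> ind B mB.
pose E i := (fun w => \sum_j a i j * x i w j 0) @^-1` B i.
have := ind [set: I]%SET E _.
rewrite (_ : [set` [set: I]%SET] = [set: I]); last first.
  by apply/seteqP; split => i //=; rewrite finset.in_setT.
move=> -> => [|i _]; last exact: sigma_of_linear.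
by apply: eq_bigl => i; rewrite finset.in_setT.
Qed.

Lemma normal_law_cos (z : Omega -> R) (a : R) : measurable_fun setT z ->
  (forall B, measurable B -> P (z @^-1` B) = normal_prob 0 1 B) ->
  [/\ \int[P]_w cos (a * z w) = expR (- (a ^+ 2 / 2)),
      \int[P]_w sin (a * z w) = 0 &
      (\int[P]_w (expR (a * z w))%:E = (expR (a ^+ 2 / 2))%:E)%E].
Proof.
move=> mz zN.
have tr0 B : measurable B -> (\int[P]_w (\1_B (z w) * cst 1 w)%:E =
    \int[normal_prob 0 1]_x (\1_B (idfun x) * cst 1 x)%:E)%E.
  move=> mB; transitivity (normal_prob 0 1 B).
    rewrite -zN// -[X in P X]setIT -integral_indic//.
      by apply: eq_integral => w _; rewrite mulr1; congr (_%:R%:E); rewrite !inE.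
    by rewrite -[X in measurable X]setTI; exact: mz.
  rewrite -[X in normal_prob _ _ X]setIT -integral_indic//.
  by apply: eq_integral => w _; rewrite mulr1.
have tr (f : R -> R) (M : R) : measurable_fun setT f -> (forall x : R, `|f x| <= M) ->
    \int[P]_w f (z w) = \int[normal_prob 0 1]_x f x.
  move=> mf fM.
  transitivity (\int[P]_w (f (z w) * cst 1 w)).
    by apply: eq_Rintegral => w _; rewrite mulr1.
  rewrite (Rintegral_transfer (m2 := normal_prob 0 1) (y2 := idfun)
    (w2 := cst 1) _ _ _ _ _ _ tr0 _ _ mf fM)//.
  - by apply: eq_Rintegral => w _; rewrite mulr1.
  - exact: measurable_id.
  - exact: finite_measure_integrable_cst.
  - exact: finite_measure_integrable_cst.
have ma : measurable_fun setT (fun x : R => a * x) by exact: measurable_funM.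
have nc c : \int[P]_w cos (a * z w + c) = expR (- (a ^+ 2 / 2)) * cos c.
  rewrite -normal_cos (tr (fun x => cos (a * x + c)) 1)//.
    apply: measurableT_comp => //; last exact: measurable_funD.
    exact: continuous_measurable_fun (@continuous_cos R).
  by move=> x; rewrite ler_norml cos_geN1 cos_le1.
split.
- have := nc 0; rewrite cos0 mulr1 => <-.
  by apply: eq_Rintegral => w _; rewrite addr0.
(* The sine is the cosine with phase [- pi / 2]. *)
- have := nc (- (pi / 2)); rewrite cosN cos_pihalf mulr0 => <-.
  by apply: eq_Rintegral => w _; rewrite cosB cos_pihalf sin_pihalf mulr0 add0r mulr1.
- rewrite -normal_expR.
  transitivity (\int[P]_w ((expR (a * z w))%:E * (cst 1 w)%:E))%E.
    by apply: eq_integral => w _; rewrite mule1.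
  rewrite (ge0_integral_transfer (f := fun x => (expR (a * x))%:E)
    (m2 := normal_prob 0 1) (y2 := idfun) (w2 := cst 1) _ _ _ _ _ _ tr0)//.
  + by apply: eq_integral => w _; rewrite mule1.
  + exact: measurable_id.
  + by apply/measurable_EFinP; exact: measurableT_comp.
Qed.

Lemma standard_normal_linear l (z : Omega -> 'cV[R]_l) (a : 'I_l -> R) :
  standard_normal_vector P z ->
  [/\ \int[P]_w cos (\sum_k a k * z w k 0) = expR (- ((\sum_k a k ^+ 2) / 2)),
      \int[P]_w sin (\sum_k a k * z w k 0) = 0 &
      (\int[P]_w (expR (\sum_k a k * z w k 0))%:E =
       (expR ((\sum_k a k ^+ 2) / 2))%:E)%E].
Proof.
move=> [mz zN ind].
have mzk k : measurable_fun setT (fun w => a k * z w k 0).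
  by apply: measurable_funM => //; exact: mz.
have iz : independent_rvs P (fun k w => a k * z w k 0).
  have := independent_linear (fun k (_ : 'I_1) => a k) ind.
  rewrite /independent_rvs => + B mB => /(_ B mB).
  have E k : (fun w => \sum_(j < 1) a k * ((z w k 0)%:M : 'cV[R]_1) j 0) =
      (fun w => a k * z w k 0).
    by apply/funext => w; rewrite big_ord1 mxE eqxx mulr1n.
  under eq_bigcapr => k _ do rewrite E.
  by under eq_bigr => k _ do rewrite E.
have law k := normal_law_cos (a k) (mz k 0) (zN k).
have lc k : \int[P]_w cos (a k * z w k 0) = expR (- (a k ^+ 2 / 2)) by case: (law k).
have ls k : \int[P]_w sin (a k * z w k 0) = 0 by case: (law k).
have le k : (\int[P]_w (expR (a k * z w k 0))%:E = (expR (a k ^+ 2 / 2))%:E)%E.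
  by case: (law k).
have [c s] := integral_cos_sum mzk iz lc ls.
split => //.
- by rewrite c -expR_sum; congr expR; rewrite sumrN mulr_suml.
- rewrite (integral_expR_sum mzk iz _ le).
    by rewrite -expR_sum mulr_suml.
  by move=> k; exact: expR_ge0.
Qed.

(** The form [h^T X u] is a sum over the rows of independent centred normal
    variables, of variances [h_i^2 (u^T Sigma u)]. *)
Lemma gaussian_rows_bilinear n p (Sigma : 'M[R]_p) (X : Omega -> 'M[R]_(n, p))
    (h : 'cV[R]_n) (u : 'cV[R]_p) :
  iid_gaussian_rows P Sigma X ->
  let q := (\sum_i h i 0 ^+ 2) * (u^T *m Sigma *m u) 0 0 in
  \int[P]_w cos ((h^T *m X w *m u) 0 0) = expR (- (q / 2)) /\
  (\int[P]_w (expR ((h^T *m X w *m u) 0 0))%:E = (expR (q / 2))%:E)%E.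
Proof.
move=> [ind gx] q.
pose y i w := \sum_j (h i 0 * u j 0) * (row i (X w))^T j 0.
have yE w : (h^T *m X w *m u) 0 0 = \sum_i y i w.
  rewrite -mulmxA mxE; apply: eq_bigr => i _; rewrite /y !mxE big_distrr/=.
  by apply: eq_bigr => j _; rewrite !mxE; ring.
have iy : independent_rvs P y by exact: independent_linear ind.
pose qi i := h i 0 ^+ 2 * (u^T *m Sigma *m u) 0 0.
have law i : [/\ measurable_fun setT (y i),
    \int[P]_w cos (y i w) = expR (- (qi i / 2)),
    \int[P]_w sin (y i w) = 0 &
    (\int[P]_w (expR (y i w))%:E = (expR (qi i / 2))%:E)%E].
  have [l [A [z [zN SE xE]]]] := gx i.
  pose a k := h i 0 * (u^T *m A) 0 k.
  have yz : y i = fun w => \sum_k a k * z w k 0.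
    apply/funext => w; rewrite /y.
    transitivity (h i 0 * (u^T *m ((row i (X w))^T)) 0 0).
      rewrite mxE big_distrr/=; apply: eq_bigr => j _.
      by rewrite [u^T _ _]mxE mulrA.
    rewrite xE mulmxA mxE big_distrr/=.
    by apply: eq_bigr => k _; rewrite mulrA.
  have aq : \sum_k a k ^+ 2 = qi i.
    rewrite /qi SE mulmxA -mulmxA.
    have -> : A^T *m u = (u^T *m A)^T by rewrite trmx_mul trmxK.
    rewrite [(_ *m _^T) 0 0]mxE big_distrr/=; apply: eq_bigr => k _.
    by rewrite /a exprMn [(_^T) _ _]mxE expr2.
  have [c s e] := standard_normal_linear a zN.
  rewrite yz; split; rewrite ?c ?s ?e ?aq//.
  case: zN => mz _ _; apply: measurable_sum => k.
  by apply: measurable_funM => //; exact: mz.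
have my i : measurable_fun setT (y i) by case: (law i).
have lc i : \int[P]_w cos (y i w) = expR (- (qi i / 2)) by case: (law i).
have ls i : \int[P]_w sin (y i w) = 0 by case: (law i).
have le i : (\int[P]_w (expR (y i w))%:E = (expR (qi i / 2))%:E)%E by case: (law i).
have qE : q = \sum_i qi i by rewrite /q mulr_suml.
split.
- under eq_Rintegral do rewrite yE.
  have [-> _] := integral_cos_sum my iy lc ls.
  by rewrite -expR_sum qE sumrN mulr_suml.
- under eq_integral do rewrite yE.
  rewrite (integral_expR_sum my iy _ le); last by move=> i; exact: expR_ge0.
  by rewrite -expR_sum qE mulr_suml.
Qed.

End gaussian_vectors.

(** * Small balls and tails for matrices with Gaussian-like bilinear forms *)

Section squared_norm.
Context {R : realType}.

Definition sqn k (u : 'cV[R]_k) : R := \sum_i u i 0 ^+ 2.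

Lemma sqn_ge0 k (u : 'cV[R]_k) : 0 <= sqn u.
Proof. by apply: sumr_ge0 => i _; rewrite sqr_ge0. Qed.

Lemma sqnZ k a (u : 'cV[R]_k) : sqn (a *: u) = a ^+ 2 * sqn u.
Proof. by rewrite /sqn big_distrr/=; apply: eq_bigr => i _; rewrite mxE exprMn. Qed.

Lemma sqn_eq0 n (u : 'cV[R]_n) : sqn u = 0 -> u = 0.
Proof.
move=> /eqP; rewrite psumr_eq0; last by move=> i _; exact: sqr_ge0.
move=> /allP H; apply/colP => j.
by have := H j (mem_index_enum j); rewrite !mxE/= sqrf_eq0 => /eqP.
Qed.

Lemma sqnD_le k (u v : 'cV[R]_k) : sqn (u + v) <= 2 * sqn u + 2 * sqn v.
Proof.
rewrite /sqn !big_distrr -big_split/=; apply: ler_sum => i _; rewrite mxE.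
by have := sqr_ge0 (u i 0 - v i 0); nra.
Qed.

Lemma dot_le k (u v : 'cV[R]_k) a b : 0 < a -> 0 < b ->
  sqn u <= a ^+ 2 -> sqn v <= b ^+ 2 -> (u^T *m v) 0 0 <= a * b.
Proof.
move=> a0 b0 ua vb.
have : 0 <= \sum_i (b * u i 0 - a * v i 0) ^+ 2.
  by apply: sumr_ge0 => i _; exact: sqr_ge0.
have -> : \sum_i (b * u i 0 - a * v i 0) ^+ 2 =
    b ^+ 2 * sqn u + a ^+ 2 * sqn v - 2 * (a * b) * (u^T *m v) 0 0.
  rewrite /sqn [(_ *m _) 0 0]mxE !big_distrr -big_split -sumrB/=.
  by apply: eq_bigr => i _; rewrite mxE; ring.
move=> H; have ab0 : 0 < a * b by rewrite mulr_gt0.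
have h1 : b ^+ 2 * sqn u <= b ^+ 2 * a ^+ 2 by rewrite ler_wpM2l// sqr_ge0.
have h2 : a ^+ 2 * sqn v <= a ^+ 2 * b ^+ 2 by rewrite ler_wpM2l// sqr_ge0.
have : (a * b) * (u^T *m v) 0 0 <= (a * b) * (a * b) by lra.
by rewrite ler_pM2l.
Qed.

End squared_norm.

Section gaussian_like.
Context d (Omega : measurableType d) (R : realType).
Variable P : probability Omega R.

(** The two features of a Gaussian matrix that the estimates rely on; [c] and
    [C] stand for bounds on the spectrum of the covariance. *)
Definition gaussian_like (c C : R) n m (M : Omega -> 'M[R]_(n, m)) : Prop :=
  [/\ random_matrix M,
      forall h u, \int[P]_w cos ((h^T *m M w *m u) 0 0) <=
        expR (- (c / 2 * (sqn h * sqn u))) &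
      forall h u, (\int[P]_w (expR ((h^T *m M w *m u) 0 0))%:E <=
        (expR (C / 2 * (sqn h * sqn u)))%:E)%E].

Lemma gaussian_like_tr c C n m (M : Omega -> 'M[R]_(n, m)) :
  gaussian_like c C M -> gaussian_like c C (fun w => (M w)^T).
Proof.
have tr w (h : 'cV_m) (u : 'cV_n) : (h^T *m (M w)^T *m u) 0 0 = (u^T *m M w *m h) 0 0.
  have -> : h^T *m (M w)^T *m u = (u^T *m M w *m h)^T.
    by rewrite !trmx_mul trmxK mulmxA.
  by rewrite mxE.
move=> [mM cM eM]; split=> [i j|h u|h u].
- by under eq_fun do rewrite mxE; exact: mM.
- by under eq_Rintegral do rewrite tr; rewrite [sqn h * _]mulrC; exact: cM.
- by under eq_integral do rewrite tr; rewrite [sqn h * _]mulrC; exact: eM.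
Qed.

Lemma gaussian_rows_like c C n p (Sigma : 'M[R]_p) (X : Omega -> 'M[R]_(n, p)) :
  (forall u : 'cV_p, c * sqn u <= (u^T *m Sigma *m u) 0 0 <= C * sqn u) ->
  iid_gaussian_rows P Sigma X -> gaussian_like c C X.
Proof.
move=> cC gX; split=> [i j|h u|h u].
- have [l [A [z [[mz _ _] _ xE]]]] := gX.2 i.
  have -> : (fun w => X w i j) = fun w => \sum_k A j k * z w k 0.
    apply/funext => w; have := congr1 (fun v : 'cV_p => v j 0) (xE w).
    by rewrite !mxE.
  by apply: measurable_sum => k; apply: measurable_funM => //; exact: mz.
- have [-> _] := gaussian_rows_bilinear h u gX.
  rewrite ler_expR lerN2; have /andP[cu _] := cC u.
  have := ler_wpM2l (sqn_ge0 h) cu; rewrite /sqn; lra.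
- have [_ ->] := gaussian_rows_bilinear h u gX.
  rewrite lee_fin ler_expR; have /andP[_ cu] := cC u.
  have := ler_wpM2l (sqn_ge0 h) cu; rewrite /sqn; lra.
Qed.

Lemma markov_bound (A : set Omega) (f : Omega -> R) (t b : R) : measurable A ->
  measurable_fun setT f -> (forall w, 0 <= f w) -> 0 < t ->
  (forall w, A w -> t <= f w) -> (\int[P]_w (f w)%:E <= b%:E)%E ->
  (P A <= (b / t)%:E)%E.
Proof.
move=> mA mf f0 t0 Af fb.
have PA : P A \is a fin_num by rewrite fin_num_measure.
rewrite -(fineK PA) lee_fin ler_pdivlMr// mulrC -lee_fin EFinM fineK//.
apply: le_trans fb; rewrite -[X in P X]setIT -integral_indic//.
rewrite -ge0_integralZl_EFin ?(ltW t0)//; last exact/measurable_EFinP.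
apply: ge0_le_integral => //.
- by move=> w _; rewrite mule_ge0// lee_fin ?ltW// indicE.
- by apply: emeasurable_funM => //; exact/measurable_EFinP.
- exact/measurable_EFinP.
- move=> w _; rewrite -EFinM lee_fin indicE.
  by have [/set_mem/Af|_] := boolP (w \in A); rewrite ?mulr1 ?mulr0.
Qed.

Section tails.
Variables (c C : R) (n m : nat) (M : Omega -> 'M[R]_(n, m)).
Hypotheses (c0 : 0 < c) (gM : gaussian_like c C M).

Implicit Types (h : 'cV[R]_n) (u : 'cV[R]_m).

Lemma measurable_bilinear h u : measurable_fun setT (fun w => (h^T *m M w *m u) 0 0).
Proof.
have [mM _ _] := gM.
under eq_fun do rewrite -mulmxA mxE.
apply: measurable_sum => i; apply: measurable_funM => //.
under eq_fun do rewrite mxE.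
by apply: measurable_sum => j; apply: measurable_funM => //; exact: mM.
Qed.

Lemma measurable_sqn u : measurable_fun setT (fun w => sqn (M w *m u)).
Proof.
have [mM _ _] := gM.
apply: measurable_sum => i; apply: measurable_funX.
under eq_fun do rewrite mxE.
by apply: measurable_sum => j; apply: measurable_funM => //; exact: mM.
Qed.

Lemma gaussian_like_laplace u s : 0 <= s ->
  \int[P]_w expR (- (s * sqn (M w *m u))) <=
  (Num.sqrt (1 + 2 * (s * (c * sqn u))))^-1 ^+ n.
Proof.
move=> s0; rewrite -[X in _ <= _ ^+ X]card_ord.
apply: (@integral_expR_Nsqr_le _ _ _ P _ (fun i w => (M w *m u) i 0)) => //.
- move=> i; have [mM _ _] := gM; under eq_fun do rewrite mxE.
  by apply: measurable_sum => j; apply: measurable_funM => //; exact: mM.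
- by rewrite mulr_ge0 ?sqn_ge0// ltW.
- move=> h; have [_ cM _] := gM.
  have := cM (\col_i h i) u; congr (_ <= _).
    apply: eq_Rintegral => w _; congr cos; rewrite -mulmxA mxE.
    by apply: eq_bigr => i _; rewrite !mxE.
  congr (expR (- _)); rewrite /sqn [\sum_i (\col_i h i) i 0 ^+ 2](eq_bigr (fun i => h i ^+ 2)).
    by ring.
  by move=> i _; rewrite mxE.
Qed.

(** Markov's inequality for [exp (- |M u|^2 / rho^2)], whose mean is of order
    [rho^n]. *)
Lemma small_ball u nu rho : 0 < nu -> nu <= sqn u -> 0 < rho ->
  (P [set w | sqn (M w *m u) <= n%:R * rho ^+ 2]%R <=
   ((expR 1 * rho / Num.sqrt (2 * c * nu)) ^+ n)%:E)%E.
Proof.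
move=> nu0 nuu rho0.
pose s := (rho ^+ 2)^-1.
have s0 : 0 < s by rewrite invr_gt0 exprn_gt0.
set A := [set w | _].
have mA : measurable A.
  rewrite -[A]setTI (_ : A = (fun w => sqn (M w *m u)) @^-1` `]-oo, n%:R * rho ^+ 2]%classic).
    exact: (measurable_sqn u measurableT (measurable_itv _)).
  by apply/seteqP; split => w; rewrite /A /= in_itv.
have mf : measurable_fun setT (fun w => expR (- (s * sqn (M w *m u)))).
  apply: measurableT_comp => //; apply: measurableT_comp => //.
  by apply: measurable_funM => //; exact: measurable_sqn.
apply: le_trans (markov_bound (b := (rho / Num.sqrt (2 * c * nu)) ^+ n)
  (t := expR (- n%:R)) mA mf _ _ _ _) _.
- by move=> w; exact: expR_ge0.
- exact: expR_gt0.
- move=> w Aw; rewrite ler_expR lerN2 /s mulrC ler_pdivrMr ?exprn_gt0//.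
- rewrite EFin_Rintegral; last first.
    apply: (@bounded_integrable _ _ _ _ _ 1) => // w.
    by rewrite ger0_norm ?expR_ge0// -expR0 ler_expR oppr_le0 mulr_ge0 ?sqn_ge0// ltW.
  rewrite lee_fin (le_trans (gaussian_like_laplace _ (ltW s0)))//.
  rewrite lerXn2r ?nnegrE ?invr_ge0 ?divr_ge0 ?(ltW rho0)//.
  have rE : rho = (Num.sqrt s)^-1.
    by rewrite /s sqrtrV ?invrK ?sqr_ge0// sqrtr_sqr gtr0_norm.
  have b1 : 0 < 1 + 2 * (s * (c * sqn u)).
    by rewrite addr_gt0// !mulr_gt0// (lt_le_trans nu0).
  have b2 : 0 < s * (2 * c * nu) by rewrite !mulr_gt0.
  rewrite {1}rE -invfM -sqrtrM ?(ltW s0)// lef_pV2 ?posrE ?sqrtr_gt0//.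
  rewrite ler_sqrt ?(ltW b1)//.
  have : s * (c * nu) <= s * (c * sqn u) by rewrite !ler_pM2l.
  lra.
- rewrite lee_fin expRN invrK -[X in expR X]mulr1 mulrC expRM_natl -exprMn mulrA//.
Qed.

(** Exponential Markov inequality with exponent [sqrt n]. The decay obtained is
    exponential in [x] rather than Gaussian, which still beats every power of [x]. *)
Lemma bilinear_tail h u x : 0 <= C -> sqn h <= 1 -> sqn u <= 1 -> 
  (P [set w | (h^T *m M w *m u) 0%R 0%R >= x * Num.sqrt n%:R / 2]%R <=
   (expR ((C - x) / 2) ^+ n)%:E)%E.
Proof.
move=> C0 h1 u1; set r := Num.sqrt n%:R.
set A := [set w | _].
have r2 : r ^+ 2 = n%:R by rewrite sqr_sqrtr.
have mA : measurable A.
  rewrite -[A]setTI (_ : A = (fun w => (h^T *m M w *m u) 0 0) @^-1` `[x * r / 2, +oo[%classic).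
    exact: (measurable_bilinear h u measurableT (measurable_itv _)).
  by apply/seteqP; split => w; rewrite /A /= in_itv /= andbT.
have mf := measurable_bilinear (r *: h) u.
have rh w : ((r *: h)^T *m M w *m u) 0 0 = r * (h^T *m M w *m u) 0 0.
  by rewrite linearZ/= -!scalemxAl mxE.
apply: le_trans (markov_bound (b := expR (C / 2 * n%:R)) (t := expR (n%:R * x / 2)) mA
  (measurableT_comp (@measurable_expR R) mf) _ _ _ _) _.
- by move=> w; exact: expR_ge0.
- exact: expR_gt0.
- move=> w /= Aw; rewrite ler_expR rh -r2.
  by rewrite (le_trans _ (ler_wpM2l (sqrtr_ge0 _) Aw))// -/r; lra.
- have [_ _ eM] := gM; apply: le_trans (eM (r *: h) u) _.
  rewrite lee_fin ler_expR ler_wpM2l ?divr_ge0// sqnZ r2 -mulrA.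
  by rewrite ler_piMr// mulr_ile1// sqn_ge0.
- rewrite lee_fin -expRN -expRD -expRM_natl ler_expR le_eqVlt.
  by apply/orP; left; apply/eqP; field.
Qed.

End tails.
End gaussian_like.

(** * Lattice nets of the unit ball *)

Notation lattice_index m D := {ffun 'I_m -> bool * 'I_(D * m).+1}.

Section lattice.
Context {R : realType}.
Variables m D : nat.
Hypotheses (m0 : (0 < m)%N) (D0 : (0 < D)%N).

(** The lattice of mesh [1 / (D sqrt m)], with coordinates coded by sign and
    size. *)
Definition lattice_pt (k : lattice_index m D) : 'cV[R]_m :=
  \col_i ((-1) ^+ (k i).1 * (k i).2%:R / (D%:R * Num.sqrt m%:R)).

(** The constraint comes from [|u|_1 <= sqrt m |u|_2]: once rounded, a vector of
    the unit ball has sizes of sum at most [D m]. Counting under this constraint gives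
    [(const D)^m] points, with no factor growing with [m]. *)
Definition lattice_net : {set lattice_index m D} :=
  [set k : lattice_index m D | (\sum_i (k i).2 <= D * m)%N].

(** Generating function: weigh every index by [w] to the sum of its sizes, with
    [w = D / (D + 1)]. The total weight is at most [(2 (D + 1))^m], whereas a member
    of the net weighs at least [w^(D m) >= e^-m]. *)
Lemma card_lattice_net : #|lattice_net|%:R <= (4 * expR 1 * D%:R) ^+ m :> R.
Proof.
pose w : R := D%:R / D.+1%:R.
have D0' : 0 < D%:R :> R by rewrite ltr0n.
have w0 : 0 < w by rewrite divr_gt0.
have w1 : w < 1 by rewrite ltr_pdivrMr// mul1r ltr_nat.
have geo : \sum_(a < (D * m).+1) w ^+ a <= D.+1%:R.
  have DS : 0 < D.+1%:R :> R by rewrite ltr0n.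
  have e1 : (w - 1) * D.+1%:R = -1.
    by rewrite mulrBl divfK ?gt_eqF// mul1r -natr1; lra.
  have := subrX1 w (D * m).+1.
  have := exprn_ge0 (D * m).+1 (ltW w0).
  move: (w ^+ _) (\sum_(_ < _) _) => W G W0 E.
  have : (w - 1) * D.+1%:R * G = (W - 1) * D.+1%:R by rewrite E mulrAC.
  rewrite e1; nra.
have key : #|lattice_net|%:R * w ^+ (D * m) <= (2 * D.+1%:R) ^+ m.
  apply: (@le_trans _ _ (\sum_(k : lattice_index m D) \prod_i w ^+ (k i).2)).
    rewrite -sum1_card natr_sum mulr_suml [leRHS](bigID (mem lattice_net))/=.
    rewrite -[leLHS]addr0 lerD//; last first.
      by apply: sumr_ge0 => k _; apply: prodr_ge0 => i _; rewrite exprn_ge0// ltW.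
    apply: ler_sum => k; rewrite inE mul1r prodrXr => kD.
    by rewrite ler_wiXn2l// ltW.
  rewrite -(bigA_distr_bigA (fun (i : 'I_m) (x : bool * 'I_(D * m).+1) => w ^+ x.2)).
  have G0 : 0 <= \sum_(a < (D * m).+1) w ^+ a.
    by apply: sumr_ge0 => x _; rewrite exprn_ge0// ltW.
  rewrite -(pair_bigA _ (fun (_ : bool) (a : 'I_(D * m).+1) => w ^+ a))/=.
  rewrite sumr_const card_bool mulr2n prodr_const card_ord.
  by rewrite lerXn2r ?nnegrE ?mulr_ge0 ?addr_ge0//; move: geo; lra.
have we : (w ^+ (D * m))^-1 <= expR 1 ^+ m.
  rewrite exprM -exprVn lerXn2r ?nnegrE ?invr_ge0 ?exprn_ge0 ?expR_ge0 ?(ltW w0)//.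
  rewrite -exprVn invf_div -natr1 mulrDl divff ?gt_eqF// mul1r.
  rewrite -[X in expR X](@divff _ D%:R) ?gt_eqF// expRM_natl.
  by rewrite lerXn2r ?nnegrE ?expR_ge0 ?addr_ge0 ?invr_ge0 ?(ltW D0')// expR_ge1Dx.
rewrite -ler_pdivlMr ?exprn_gt0// in key.
apply: (le_trans key); apply: (@le_trans _ _ ((2 * D.+1%:R) ^+ m * expR 1 ^+ m)).
  by rewrite ler_wpM2l// exprn_ge0// mulr_ge0.
rewrite -exprMn lerXn2r ?nnegrE ?mulr_ge0 ?expR_ge0//.
rewrite [leRHS]mulrAC ler_wpM2r ?expR_ge0// -natrM -natrM ler_nat.
by rewrite mulnS; lia.
Qed.

(** Coordinates are rounded towards 0, so that each moves by at most the mesh and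
    the norm does not grow. *)
Lemma lattice_round (u : 'cV[R]_m) : sqn u <= 1 ->
  exists k, [/\ k \in lattice_net, sqn (u - lattice_pt k) <= D%:R ^- 2 &
                sqn (lattice_pt k) <= 1].
Proof.
move=> u1; pose r : R := Num.sqrt m%:R.
have r2 : r ^+ 2 = m%:R by rewrite sqr_sqrtr.
have r0 : 0 < r by rewrite sqrtr_gt0 ltr0n.
have D0' : 0 < D%:R :> R by rewrite ltr0n.
pose a i := Num.truncn (`|u i 0| * (D%:R * r)).
have aP i : (a i)%:R <= `|u i 0| * (D%:R * r) < (a i).+1%:R.
  have x0 : 0 <= `|u i 0| * (D%:R * r) by rewrite !mulr_ge0// ltW.
  by exact: truncn_itv.
have sa : (\sum_i a i <= D * m)%N.
  rewrite -(ler_nat R) natr_sum.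
  apply: (@le_trans _ _ (\sum_i D%:R * ((m%:R * u i 0 ^+ 2 + 1) / 2))).
    apply: ler_sum => i _; have /andP[ai _] := aP i; apply: (le_trans ai).
    rewrite mulrCA ler_pM2l//.
    have := sqr_ge0 (`|u i 0| * r - 1).
    rewrite sqrrB1 exprMn r2 real_normK ?num_real//; lra.
  rewrite -big_distrr/= natrM ler_pM2l// -mulr_suml big_split/= -big_distrr/=.
  rewrite sumr_const card_ord.
  have : m%:R * sqn u <= m%:R by rewrite ler_piMr.
  rewrite /sqn; lra.
have ai i : (a i < (D * m).+1)%N.
  by rewrite ltnS (leq_trans _ sa)// (bigD1 i)//= leq_addr.
pose k : lattice_index m D := [ffun i => (u i 0 < 0, Ordinal (ai i))].
have kE i : lattice_pt k i 0 = (-1) ^+ (u i 0 < 0)%R * ((a i)%:R / (D%:R * r)).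
  by rewrite mxE ffunE/= mulrA.
have uE i : u i 0 = (-1) ^+ (u i 0 < 0)%R * `|u i 0| by exact: numEsign.
have Dr0 : 0 < D%:R * r by rewrite mulr_gt0.
exists k; split.
- by rewrite inE; under eq_bigr do rewrite ffunE.
- apply: (@le_trans _ _ (\sum_(i < m) (D%:R * r) ^- 2)).
    apply: ler_sum => i _.
    have -> : (u - lattice_pt k) i 0 = u i 0 - lattice_pt k i 0 by rewrite !mxE.
    rewrite kE {1}uE.
    rewrite -mulrBr exprMn sqrr_sign mul1r -exprVn.
    have /andP[h1 h2] := aP i.
    rewrite -natr1 in h2.
    rewrite -[leRHS]sqrrN -[leRHS]real_normK ?num_real// normrN.
    rewrite -[leLHS]real_normK ?num_real// lerXn2r ?nnegrE//.
    rewrite [leRHS]ger0_norm ?invr_ge0 ?(ltW Dr0)// ger0_norm; last first.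
      by rewrite subr_ge0 ler_pdivrMr.
    by rewrite lerBlDr -[X in _ <= X + _]mul1r -mulrDl ler_pdivlMr// addrC ltW.
  by rewrite sumr_const card_ord exprMn r2 -[_ *+ m]mulr_natl invfM mulrCA divff ?mulr1// pnatr_eq0 -lt0n.
- apply: le_trans u1; apply: ler_sum => i _.
  rewrite kE {2}uE exprMn [leRHS]exprMn !sqrr_sign !mul1r lerXn2r ?nnegrE ?divr_ge0 ?(ltW Dr0)//.
  by rewrite ler_pdivrMr//; case/andP: (aP i).
Qed.

End lattice.

(** * Tail events for the extreme singular values *)

Section union_bound.
Context d (Omega : measurableType d) (R : realType) (P : probability Omega R).

Lemma union_bound (T : finType) (K : {set T}) (A : T -> set Omega) (b : R) :
  (forall k, measurable (A k)) -> (forall k, k \in K -> (P (A k) <= b%:E)%E) ->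
  (P (\big[setU/set0]_(k in K) A k) <= (#|K|%:R * b)%:E)%E.
Proof.
move=> mA Ab.
have [_ /le_trans] : measurable (\big[setU/set0]_(k in K) A k) /\
    (P (\big[setU/set0]_(k in K) A k) <= \sum_(k in K) P (A k))%E.
  elim/big_rec2 : _ => [|k x y kK [my yx]]; first by rewrite measure0.
  split; first exact: measurableU.
  by rewrite (le_trans (measureU2 _ _ _))// leeD2l.
apply; apply: (@le_trans _ _ (\sum_(k in K) b%:E)%E); first exact: lee_sum.
by rewrite sumEFin sumr_const mulr_natl.
Qed.

Lemma mem_bigsetU (T : finType) (K : {set T}) (A : T -> set Omega) k w :
  k \in K -> A k w -> (\big[setU/set0]_(k in K) A k) w.
Proof. by move=> kK Akw; rewrite (bigD1 k)//=; left. Qed.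

End union_bound.

Section condition_tail.
Context d (Omega : measurableType d) (R : realType) (P : probability Omega R).
Variables (c C : R) (n m : nat) (M : Omega -> 'M[R]_(n, m)).
Hypotheses (c0 : 0 < c) (C0 : 0 <= C) (gM : gaussian_like P c C M).
Hypotheses (m0 : (0 < m)%N) (mn : (m <= n)%N).

Local Notation e1 := (expR 1 : R).

(** Let [s^2 = lam]. The bilinear form equals [s] at the maximising pair of unit
    vectors; moving either of them to a net of mesh [1/4] loses at most [s / 4], so
    that some pair of net points sees at least [s / 2 >= x sqrt n / 2]. The bound on
    [P E] is the union bound over these pairs. *)
Lemma upper_event (x : R) : exists E : set Omega,
  [/\ measurable E,
      (P E <= (((16 * e1) ^+ 2 * expR ((C - x) / 2)) ^+ n)%:E)%E &
      forall w (lam : R) u, 0 < lam -> 0 <= x -> x ^+ 2 * n%:R <= lam ->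
        (forall v, sqn (M w *m v) <= lam * sqn v) -> sqn u = 1 ->
        sqn (M w *m u) = lam -> E w].
Proof.
have n0 : (0 < n)%N by exact: leq_trans mn.
pose K := finset.setX [set k in lattice_net m 4 | sqn (lattice_pt k : 'cV[R]_m) <= 1]
  [set l in lattice_net n 4 | sqn (lattice_pt l : 'cV[R]_n) <= 1].
pose A (kl : lattice_index m 4 * lattice_index n 4) := [set w | x * Num.sqrt n%:R / 2 <=
  ((lattice_pt kl.2)^T *m M w *m (lattice_pt kl.1 : 'cV[R]_m)) 0 0].
have mA kl : measurable (A kl).
  set g := fun w => ((lattice_pt kl.2)^T *m M w *m (lattice_pt kl.1 : 'cV[R]_m)) 0 0.
  rewrite -[A kl]setTI (_ : A kl = g @^-1` `[x * Num.sqrt n%:R / 2, +oo[%classic).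
    exact: (measurable_bilinear gM _ _ measurableT (measurable_itv _)).
  by apply/seteqP; split => w; rewrite /A /= in_itv /= andbT.
exists (\big[setU/set0]_(kl in K) A kl); split.
- exact: bigsetU_measurable.
- apply: le_trans (union_bound (b := expR ((C - x) / 2) ^+ n) mA _) _.
    move=> kl; rewrite !inE => /andP[/andP[_ k1] /andP[_ l1]].
    exact: (bilinear_tail gM x C0 l1 k1).
  rewrite lee_fin exprMn ler_wpM2r ?exprn_ge0 ?expR_ge0//.
  rewrite cardsX natrM expr2 exprMn.
  have e16 : 1 <= 16 * e1 by have := expR_ge1Dx (1 : R); rewrite -/e1; lra.
  have net k : (0 < k)%N -> (k <= n)%N ->
      #|[set l in lattice_net k 4 | sqn (lattice_pt l : 'cV[R]_k) <= 1]|%:R <= (16 * e1) ^+ n.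
    move=> k0 kn; apply: (@le_trans _ _ #|lattice_net k 4|%:R).
      rewrite ler_nat subset_leq_card//; apply/fintype.subsetP => l.
      by rewrite inE => /andP[].
    apply: le_trans (card_lattice_net k0 _) _ => //.
    rewrite (_ : 4 * e1 * 4 = 16 * e1); last by ring.
    exact: ler_weXn2l.
  by rewrite ler_pM// ?ler0n// net.
- move=> w lam u lam0 x0 xlam Mlam u1 Mu.
  pose s := Num.sqrt lam.
  have s0 : 0 < s by rewrite sqrtr_gt0.
  have s2 : s ^+ 2 = lam by rewrite sqr_sqrtr// ltW.
  pose v : 'cV[R]_n := s^-1 *: (M w *m u).
  have v1 : sqn v = 1 by rewrite sqnZ Mu -s2 exprVn mulVf// expf_neq0// gt_eqF.
  have ule : sqn u <= 1 by rewrite u1.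
  have vle : sqn v <= 1 by rewrite v1.
  have [k [kK uk k1]] := lattice_round m0 (isT : 0 < 4)%N ule.
  have [l [lK vl l1]] := lattice_round n0 (isT : 0 < 4)%N vle.
  apply: (@mem_bigsetU _ _ _ _ _ (k, l)).
    by rewrite !inE /= k1 l1 !andbT; move: kK lK; rewrite !inE => -> ->.
  rewrite /A /=; set u' := lattice_pt k; set v' := lattice_pt l.
  have Msq z r : sqn z <= r ^+ 2 -> sqn (M w *m z) <= (s * r) ^+ 2.
    move=> zr; rewrite exprMn s2 (le_trans (Mlam z))// ler_wpM2l// ltW//.
  have q4 : (4%:R ^- 2 : R) = (4^-1) ^+ 2 by rewrite exprVn.
  have B0 : (v^T *m (M w *m u)) 0 0 = s.
    rewrite /v linearZ/= -scalemxAl mxE [X in _ * X]mxE.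
    under eq_bigr do rewrite mxE -expr2.
    by rewrite -/(sqn _) Mu -s2 expr2 mulrA mulVf ?mul1r// gt_eqF.
  have B1 : (v^T *m (M w *m (u - u'))) 0 0 <= 1 * (s * 4^-1).
    by apply: dot_le; rewrite ?mulr_gt0// ?v1 ?expr1n//; apply: Msq; rewrite -q4.
  have B2 : ((v - v')^T *m (M w *m u')) 0 0 <= 4^-1 * (s * 1).
    by apply: dot_le; rewrite ?mulr1// -?q4// -[s]mulr1 Msq// expr1n.
  have E1 : (v^T *m (M w *m u)) 0 0 =
      (v^T *m (M w *m (u - u'))) 0 0 + (v^T *m (M w *m u')) 0 0.
    by rewrite -[in LHS](subrK u' u) mulmxDr mulmxDr mxE.
  have E2 : (v^T *m (M w *m u')) 0 0 =
      ((v - v')^T *m (M w *m u')) 0 0 + (v'^T *m M w *m u') 0 0.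
    by rewrite -mulmxA -[in LHS](subrK v' v) linearD/= mulmxDl mxE.
  have xs : x * Num.sqrt n%:R <= s.
    rewrite -[X in X * _](ger0_norm x0) -sqrtr_sqr -sqrtrM ?sqr_ge0//.
    by rewrite ler_sqrt// ltW.
  by move: B0 B1 B2; rewrite E1 E2; lra.
Qed.

(** On a net of mesh [x^-q], the point [u'] nearest to [u] satisfies
    [|M u'|^2 <= 4 x^(2-2q) n], as [lam <= x^2 n] controls the rounding error. The
    union bound multiplies [(const x^q)^m] points by the small ball probability
    [(const x^(1-q))^n], and [3 n <= q (n - m)] makes the exponent of [x] at most
    [- 2 n]. *)
Lemma lower_event (x q : nat) : (2 <= x)%N -> (0 < q)%N ->
    (3 * n <= q * (n - m))%N ->
  exists E : set Omega,
  [/\ measurable E,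
      (P E <= (((4 * e1) * (2 * e1 / Num.sqrt (c / 2)) / x%:R ^+ 2) ^+ n)%:E)%E &
      forall w (lam mu : R) u, lam <= x%:R ^+ 2 * n%:R ->
        mu * x%:R ^+ (2 * q) <= lam ->
        (forall v, sqn (M w *m v) <= lam * sqn v) -> sqn u = 1 ->
        sqn (M w *m u) = mu -> E w].
Proof.
move=> x2 q0 qnm; pose D := (x ^ q)%N.
have x0 : 0 < x%:R :> R by rewrite ltr0n (leq_trans _ x2).
have D2 : (2 <= D)%N by rewrite (leq_trans x2)// /D -{1}[x]expn1 leq_exp2l.
have D0 : (0 < D)%N by exact: leq_trans D2.
have DR : 0 < D%:R :> R by rewrite ltr0n.
pose rho : R := 2 * x%:R / D%:R.
have rho0 : 0 < rho by rewrite divr_gt0// mulr_gt0.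
(* Rounding shortens vectors; since [D >= 2], a unit vector keeps at least half
   of its length. *)
pose K := [set k in lattice_net m D | 4^-1 <= sqn (lattice_pt k : 'cV[R]_m)].
pose A (k : lattice_index m D) := [set w |
  sqn (M w *m (lattice_pt k : 'cV[R]_m)) <= n%:R * rho ^+ 2].
have mA k : measurable (A k).
  set g := fun w => sqn (M w *m (lattice_pt k : 'cV[R]_m)).
  rewrite -[A k]setTI (_ : A k = g @^-1` `]-oo, n%:R * rho ^+ 2]%classic).
    exact: (measurable_sqn gM _ measurableT (measurable_itv _)).
  by apply/seteqP; split => w; rewrite /A /= in_itv.
exists (\big[setU/set0]_(k in K) A k); split.
- exact: bigsetU_measurable.
- apply: le_trans (union_bound (b := (e1 * rho / Num.sqrt (2 * c * 4^-1)) ^+ n) mA _) _.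
    move=> k; rewrite inE => /andP[_ k4].
    by apply: (small_ball c0 gM) => //; rewrite invr_gt0.
  rewrite lee_fin.
  have -> : 2 * c * 4^-1 = c / 2 by field.
  set a := Num.sqrt (c / 2); have a0 : 0 < a by rewrite sqrtr_gt0 divr_gt0.
  have e10 : 0 < e1 by exact: expR_gt0.
  have KD : #|K|%:R <= (4 * e1) ^+ n * D%:R ^+ m :> R.
    apply: (@le_trans _ _ #|lattice_net m D|%:R).
      rewrite ler_nat subset_leq_card//; apply/fintype.subsetP => l.
      by rewrite inE => /andP[].
    apply: le_trans (card_lattice_net m0 D0) _.
    rewrite exprMn ler_wpM2r ?exprn_ge0//.
    by rewrite ler_weXn2l//; have := expR_ge1Dx (1 : R); rewrite -/e1; lra.
  apply: (@le_trans _ _ (((4 * e1) ^+ n * D%:R ^+ m) * (e1 * rho / a) ^+ n)).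
    by rewrite ler_wpM2r// exprn_ge0// divr_ge0 ?ltW// mulr_gt0.
  have -> : (4 * e1) ^+ n * D%:R ^+ m * (e1 * rho / a) ^+ n =
     (4 * e1 * (2 * e1 / a)) ^+ n * (D%:R ^+ m * (x%:R / D%:R) ^+ n).
    have -> : e1 * rho / a = (2 * e1 / a) * (x%:R / D%:R).
      by rewrite /rho; field; rewrite !gt_eqF.
    by rewrite [in LHS](exprMn _ (2 * e1 / a)) [in RHS](exprMn _ (4 * e1)) mulrACA.
  rewrite [in leRHS]exprMn ler_wpM2l//.
    by rewrite exprn_ge0// ltW// mulr_gt0 ?divr_gt0// mulr_gt0.
  rewrite exprMn mulrA !exprVn -!exprM.
  rewrite ler_pdivrMr ?exprn_gt0// mulrC ler_pdivlMl ?exprn_gt0//.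
  rewrite -natrX -!natrX -!natrM ler_nat /D -!expnM -!expnD leq_pexp2l ?(leq_trans _ x2)//.
  have : (q * (n - m) = q * n - q * m)%N by rewrite mulnBr.
  have : (q * m <= q * n)%N by rewrite leq_mul2l mn orbT.
  lia.
- move=> w lam mu u lamx mulam Mlam u1 Mu.
  have ule : sqn u <= 1 by rewrite u1.
  have [k [kK uk k1]] := lattice_round m0 D0 ule.
  have DX : D%:R ^+ 2 = x%:R ^+ (2 * q) :> R by rewrite /D natrX -exprM mulnC.
  have DX0 : 0 < D%:R ^+ 2 :> R by rewrite exprn_gt0.
  have D4 : 4 <= D%:R ^+ 2 :> R by rewrite -natrX (ler_nat _ 4) (leq_exp2r 2 D (isT : 0 < 2)%N).
  have Di : D%:R ^- 2 <= 4^-1 :> R by rewrite lef_pV2// posrE.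
  apply: (@mem_bigsetU _ _ _ _ _ k).
    rewrite inE kK/=.
    have := sqnD_le (u - lattice_pt k) (lattice_pt k : 'cV[R]_m).
    by rewrite subrK u1; lra.
  rewrite /A /=; set u' := lattice_pt k.
  have := sqnD_le (M w *m (u' - u)) (M w *m u).
  rewrite -mulmxDr subrK Mu => /le_trans; apply.
  have -> : n%:R * rho ^+ 2 = 4 * ((x%:R ^+ 2 * n%:R) / D%:R ^+ 2).
    by rewrite /rho; field; rewrite gt_eqF.
  have lam0 : 0 <= lam by have := Mlam u; rewrite u1 mulr1 => /(le_trans (sqn_ge0 _)).
  have h1 : mu <= x%:R ^+ 2 * n%:R / D%:R ^+ 2.
    by rewrite ler_pdivlMr// DX (le_trans mulam).
  have h2 : sqn (M w *m (u' - u)) <= x%:R ^+ 2 * n%:R / D%:R ^+ 2.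
    apply: le_trans (Mlam _) _; apply: ler_pM => //; first exact: sqn_ge0.
    rewrite -opprB -scaleN1r sqnZ sqrrN expr1n mul1r//.
  lra.
Qed.

End condition_tail.

(** * Almost sure injectivity *)

Section injective.
Context d (Omega : measurableType d) (R : realType) (P : probability Omega R).
Variables (c C : R) (n m' : nat).
Local Notation m := m'.+1.
Variable M : Omega -> 'M[R]_(n, m).
Hypotheses (c0 : 0 < c) (gM : gaussian_like P c C M) (mn : (m <= n)%N).

(** Vectors with one coordinate equal to 1 and the others multiples of [1 / B] in
    [[-1, 1]]. A nonzero vector divided by its largest coordinate is within [1 / B] of
    one of them, coordinatewise. *)
Definition grid_pt B (t : 'I_m * {ffun 'I_m' -> bool * 'I_B.+1}) : 'cV[R]_m :=
  \col_i (if unlift t.1 i is Some k then (-1) ^+ (t.2 k).1 * (t.2 k).2%:R / B%:R else 1).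

(** There are at most [m (4 B)^(m-1)] grid points, each of which is sent within
    [O (1 / B)] of 0 with probability [O (B^-n)]. The bound [K] on the entries turns
    closeness to a kernel vector into smallness of the image. *)
Lemma grid_event (K B : nat) : (0 < K)%N -> (0 < B)%N -> exists E : set Omega,
  [/\ measurable E,
      (P E <= (m%:R * 4 ^+ m' * (expR 1 * (m%:R * K%:R) / Num.sqrt (2 * c)) ^+ n
               / B%:R)%:E)%E &
      forall w, (forall i j, `|M w i j| <= K%:R) ->
        (exists2 u : 'cV[R]_m, u != 0 & M w *m u = 0) -> E w].
Proof.
move=> K0 B0.
have BR : 0 < B%:R :> R by rewrite ltr0n.
have KR : 0 < K%:R :> R by rewrite ltr0n.
have mR : 0 < m%:R :> R by rewrite ltr0n.
pose rho : R := m%:R * K%:R / B%:R.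
have rho0 : 0 < rho by rewrite divr_gt0// mulr_gt0.
pose A t := [set w | sqn (M w *m @grid_pt B t) <= n%:R * rho ^+ 2].
have mA t : measurable (A t).
  set g := fun w => sqn (M w *m grid_pt t).
  rewrite -[A t]setTI (_ : A t = g @^-1` `]-oo, n%:R * rho ^+ 2]%classic).
    exact: (measurable_sqn gM _ measurableT (measurable_itv _)).
  by apply/seteqP; split => w; rewrite /A /= in_itv.
exists (\big[setU/set0]_(t in finset.setT) A t); split.
- exact: bigsetU_measurable.
- apply: le_trans (union_bound (b := (expR 1 * rho / Num.sqrt (2 * c * 1)) ^+ n) mA _) _.
    move=> t _; apply: (small_ball c0 gM) => //.
    rewrite /sqn (bigD1 t.1)//= mxE unlift_none expr1n lerDl.
    by apply: sumr_ge0 => i _; exact: sqr_ge0.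
  rewrite lee_fin mulr1 cardsT card_prod card_ord card_ffun card_prod card_bool !card_ord.
  set a := Num.sqrt (2 * c); have a0 : 0 < a by rewrite sqrtr_gt0 mulr_gt0.
  have e0 : 0 < expR 1 :> R by exact: expR_gt0.
  pose G := expR 1 * (m%:R * K%:R) / a.
  have G0 : 0 < G by rewrite divr_gt0// !mulr_gt0.
  have GB : 0 <= G / B%:R by rewrite divr_ge0// ltW.
  have -> : expR 1 * rho / a = G / B%:R by rewrite /G /rho; field; rewrite !gt_eqF.
  rewrite -/G; apply: (@le_trans _ _ ((m * (4 * B) ^ m')%:R * (G / B%:R) ^+ n)).
    rewrite ler_wpM2r ?(exprn_ge0 _ GB)// ler_nat leq_mul2l/=.
    by case: (m') => // k; rewrite leq_exp2r//; lia.
  have -> : (m * (4 * B) ^ m')%:R * (G / B%:R) ^+ n =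
      (m%:R * 4 ^+ m' * G ^+ n) * (B%:R ^+ m' / B%:R ^+ n).
    rewrite natrM natrX natrM (exprMn m' 4) (exprMn n G) exprVn.
    by move: (4 ^+ m') (B%:R ^+ m') (G ^+ n) (_ ^- n) => u v w z; ring.
  rewrite ler_wpM2l ?mulr_ge0 ?exprn_ge0 ?(ltW G0)//.
  rewrite ler_pdivrMr ?exprn_gt0// mulrC ler_pdivlMr//.
  by rewrite -exprSr -!natrX ler_nat leq_pexp2l.
- move=> w MK [u u0 Mu].
  have [j jmax] : exists j, forall i, `|u i 0| <= `|u j 0|.
    have [j _ jm] := @arg_maxP _ _ 'I_m ord0 xpredT (fun i => `|u i 0|) isT.
    by exists j => i; exact: jm.
  have uj : u j 0 != 0.
    apply: contra u0 => /eqP uj0; apply/eqP/colP => i; rewrite mxE.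
    by have := jmax i; rewrite uj0 normr0 normr_le0 => /eqP.
  pose v := (u j 0)^-1 *: u.
  have Mv : M w *m v = 0 by rewrite -scalemxAr Mu scaler0.
  have v1 i : `|v i 0| <= 1.
    by rewrite mxE normrM normfV mulrC ler_pdivrMr ?normr_gt0// mul1r.
  have vj : v j 0 = 1 by rewrite mxE mulVf.
  pose a i := Num.truncn (`|v i 0| * B%:R).
  have aP i : (a i)%:R <= `|v i 0| * B%:R < (a i).+1%:R.
    by apply: truncn_itv; rewrite mulr_ge0.
  have aB i : (a i < B.+1)%N.
    have /andP[ai _] := aP i.
    rewrite ltnS -(ler_nat R) (le_trans ai)// ler_piMl//.
  pose t : 'I_m * {ffun 'I_m' -> bool * 'I_B.+1} :=
    (j, [ffun k => (v (lift j k) 0 < 0, Ordinal (aB (lift j k)))]).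
  have tv i : `|grid_pt t i 0 - v i 0| <= B%:R^-1.
    rewrite mxE /=; case: unliftP => [k ->|->]; last first.
      by rewrite vj subrr normr0 invr_ge0.
    rewrite ffunE /=; set i' := lift j k.
    rewrite {2}[v i' 0]numEsign -mulrA -mulrBr normrM normr_sign mul1r.
    have /andP[h1 h2] := aP i'.
    rewrite distrC ger0_norm; last by rewrite subr_ge0 ler_pdivrMr.
    by rewrite lerBlDr -[X in _ <= X + _]mul1r -mulrDl ler_pdivlMr// nat1r ltW.
  apply: (@mem_bigsetU _ _ _ _ _ t); first by rewrite finset.in_setT.
  rewrite /A /=.
  have Mi i : ((M w *m grid_pt t) i 0) ^+ 2 <= rho ^+ 2.
    have -> : M w *m grid_pt t = M w *m (grid_pt t - v) by rewrite mulmxBr Mv subr0.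
    rewrite -real_normK ?num_real// lerXn2r ?nnegrE ?(ltW rho0)//.
    rewrite mxE (le_trans (ler_norm_sum _ _ _))//.
    apply: (@le_trans _ _ (\sum_(k < m) K%:R * B%:R^-1)).
      apply: ler_sum => k _; rewrite normrM ler_pM//.
      by have := tv k; rewrite !mxE.
    by rewrite sumr_const card_ord -[_ *+ m]mulr_natl mulrA.
  apply: (@le_trans _ _ (\sum_(i < n) rho ^+ 2)); first exact: ler_sum.
  by rewrite sumr_const card_ord -[_ *+ n]mulr_natl.
Qed.

(** For a fixed bound on the entries the exceptional event has probability
    [O (1 / B)] for every [B], hence is negligible; countably many bounds exhaust the
    sample space. *)
Lemma gaussian_like_injective :
  {ae P, forall w, forall u : 'cV[R]_m, M w *m u = 0 -> u = 0}.
Proof.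
pose L K : R := m%:R * 4 ^+ m' *
  (expR 1 * (m%:R * K.+1%:R) / Num.sqrt (2 * c)) ^+ n.
pose S K := [set w | (forall i j, `|M w i j| <= K.+1%:R) /\
                     (exists2 u : 'cV[R]_m, u != 0 & M w *m u = 0)].
have negS K : P.-negligible (S K).
  have /choice [E HE] B := grid_event (ltn0Sn K) (ltn0Sn B).
  have mE B : measurable (E B) by case: (HE B).
  have mI : measurable (\bigcap_B E B) by exact: bigcapT_measurable.
  exists (\bigcap_B E B); split => //; last first.
    by move=> w [MK u] B _; have [_ _] := HE B; apply.
  have PI : P (\bigcap_B E B) \is a fin_num by rewrite fin_num_measure.
  have PB B : fine (P (\bigcap_B E B)) <= L K / B.+1%:R.
    rewrite -lee_fin fineK//; have [_ PE _] := HE B; apply: le_trans PE.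
    by apply: le_measure; rewrite ?inE//; exact: bigcap_inf.
  rewrite -(fineK PI); congr EFin; apply/eqP; rewrite eq_le fine_ge0// andbT.
  rewrite leNgt; apply/negP => p0.
  have L0 : 0 <= L K.
    by rewrite !mulr_ge0// !exprn_ge0// divr_ge0 ?mulr_ge0 ?expR_ge0.
  have := PB (Num.bound (L K / fine (P (\bigcap_B E B)))).
  rewrite ler_pdivlMr// mulrC -ler_pdivlMr// leNgt => /negP; apply.
  apply: lt_le_trans (archi_boundP (divr_ge0 L0 (ltW p0))) _.
  by rewrite ler_nat.
have : P.-negligible (\bigcup_K S K) by exact: negligible_bigcup.
apply: negligibleS => w /= nw.
have [u [Mu u0]] : exists u : 'cV[R]_m, M w *m u = 0 /\ u <> 0.
  by move/existsNP: nw => [u /not_implyP ?]; exists u.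
pose s := \sum_i \sum_j `|M w i j|.
have s0 : 0 <= s by apply: sumr_ge0 => i _; exact: sumr_ge0.
exists (Num.bound s) => //; split; last by exists u => //; apply/eqP.
move=> i j; apply: (@le_trans _ _ s).
  rewrite /s (bigD1 i)//= (bigD1 j)//= -addrA lerDl addr_ge0//; first exact: sumr_ge0.
  by apply: sumr_ge0 => k _; exact: sumr_ge0.
by apply: le_trans (ltW (archi_boundP s0)) _; rewrite ler_nat.
Qed.

End injective.

(** * A moment bound for the condition number *)

Section condition_event.
Context d (Omega : measurableType d) (R : realType) (P : probability Omega R).
Variables (c C : R) (n m q : nat) (M : Omega -> 'M[R]_(n, m)).
Hypotheses (c0 : 0 < c) (C0 : 0 <= C) (gM : gaussian_like P c C M).
Hypotheses (m0 : (0 < m)%N) (mn : (m <= n)%N) (q0 : (0 < q)%N).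
Hypothesis qnm : (3 * n <= q * (n - m))%N.

Local Notation e1 := (expR 1 : R).

(** Beyond this value of [x] the constants of the two tail events are absorbed by
    one factor [x]; the 8 comes from [exp (- x / 2) <= 8 / x^2]. *)
Definition tail_const : R := (16 * e1) ^+ 2 * expR (C / 2) * 8 +
  (4 * e1) * (2 * e1 / Num.sqrt (c / 2)).

(** For [mu] the least eigenvalue of [A^T A] the ratio [lam / mu] is the squared
    condition number of [A]. *)
Definition extreme_pair (A : 'M[R]_(n, m)) (lam mu : R) : Prop :=
  [/\ forall v, sqn (A *m v) <= lam * sqn v,
      exists2 u, sqn u = 1 & sqn (A *m u) = lam &
      exists2 u, sqn u = 1 & sqn (A *m u) = mu].

(** One of the two tail events occurs, according to whether [lam] exceeds [x^2 n]. *)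
Lemma condition_event (x : nat) : (2 <= x)%N -> tail_const <= x%:R ->
  exists E : set Omega,
  [/\ measurable E, (P E <= (2 / x%:R ^+ n)%:E)%E &
      forall w lam mu, 0 < lam -> mu * x%:R ^+ (2 * q) <= lam ->
        extreme_pair (M w) lam mu -> E w].
Proof.
move=> x2 Kx.
have x0 : 0 < x%:R :> R by rewrite ltr0n (leq_trans _ x2).
have e10 : 0 < e1 by exact: expR_gt0.
have K1 : 0 <= (16 * e1) ^+ 2 * expR (C / 2) * 8.
  by rewrite !mulr_ge0 ?exprn_ge0 ?mulr_ge0 ?expR_ge0.
have K2 : 0 <= (4 * e1) * (2 * e1 / Num.sqrt (c / 2)).
  by rewrite !mulr_ge0 ?invr_ge0 ?sqrtr_ge0// ltW.
have [E1 [mE1 PE1 HE1]] := upper_event C0 gM m0 mn x%:R.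
have [E2 [mE2 PE2 HE2]] := lower_event c0 C0 gM m0 mn x2 q0 qnm.
exists (E1 `|` E2); split.
- exact: measurableU.
- apply: le_trans (measureU2 _ mE1 mE2) _.
  have -> : 2 / x%:R ^+ n = x%:R ^- n + x%:R ^- n :> R by rewrite mulrDl mul1r.
  rewrite EFinD leeD//.
    apply: le_trans PE1 _; rewrite lee_fin -exprVn lerXn2r ?nnegrE ?invr_ge0 ?(ltW x0)//.
    have ex : expR (- (x%:R / 2)) <= 8 / x%:R ^+ 2 :> R.
      rewrite expRN -[8]invrK -invfM lef_pV2 ?posrE ?expR_gt0 ?divr_gt0 ?mulr_gt0 ?invr_gt0 ?exprn_gt0//.
      have y0 : 0 <= x%:R / 2 :> R by rewrite divr_ge0 ?ltW.
      apply: le_trans (expR_ge1Dxn 1%N y0).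
      by rewrite -[(1.+1)`!]/2%N exprMn expr2; have := sqr_ge0 (x%:R : R); lra.
    rewrite (_ : (C - x%:R) / 2 = C / 2 - x%:R / 2); last by ring.
    rewrite expRD mulrA.
    apply: le_trans (ler_wpM2l _ ex) _.
      by rewrite mulr_ge0 ?expR_ge0// sqr_ge0.
    rewrite mulrA ler_pdivrMr ?exprn_gt0// expr2 [in leRHS]expr2 mulKf ?gt_eqF//.
    by apply: le_trans Kx; rewrite /tail_const -expr2 lerDl.
  apply: le_trans PE2 _; rewrite lee_fin -[leRHS]exprVn lerXn2r ?nnegrE ?invr_ge0 ?(ltW x0)//.
  rewrite ler_pdivrMr ?exprn_gt0// expr2 mulKf ?gt_eqF//.
  by apply: le_trans Kx; rewrite /tail_const lerDr.
- move=> w lam mu lam0 mulam [Mlam [u u1 uE] [v v1 vE]].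
  have [xl|xl] := lerP (x%:R ^+ 2 * n%:R) lam.
    by left; apply: (HE1 w lam u) => //; exact: ltW.
  by right; apply: (HE2 w lam mu v) => //; exact: ltW.
Qed.

End condition_event.

(** The majorant is [Y = x_0^(2q) + sum_j x_(j+1)^(2q) 1_(E_j)] with
    [x_j = 2^j x_0] and [E_j] the event of [condition_event] at [x_j]: if [lam / mu]
    lies between [x_j^(2q)] and [x_(j+1)^(2q)], then [E_j] occurs. As [2 q < n], the
    term of index [j] has mean at most [2 (2 x_j)^(2q) / x_j^n <= 2^(2q+1) / 2^j]. The
    constant [K] is the same for all sample spaces and dimensions. *)
Lemma condition_mean (R : realType) (c C : R) (q : nat) : 0 < c -> 0 <= C ->
    (0 < q)%N ->
  exists2 K : R, 0 < K &
  forall d (Omega : measurableType d) (P : probability Omega R) n m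
    (M : Omega -> 'M[R]_(n, m)),
    gaussian_like P c C M -> (0 < m)%N -> (m <= n)%N ->
    (3 * n <= q * (n - m))%N -> (2 * q < n)%N ->
  exists Y : Omega -> \bar R, [/\ measurable_fun setT Y, (forall w, 0 <= Y w)%E,
    (\int[P]_w Y w <= K%:E)%E &
    forall w lam mu, 0 < mu -> extreme_pair (M w) lam mu ->
      ((lam / mu)%:E <= Y w)%E].
Proof.
move=> c0 C0 q0.
have K0 : 0 <= tail_const c C.
  by rewrite addr_ge0// !mulr_ge0 ?exprn_ge0 ?mulr_ge0 ?expR_ge0.
pose x0 := maxn 2 (Num.bound (tail_const c C)).
have x02 : (2 <= x0)%N by rewrite leq_maxl.
have x0K : tail_const c C <= x0%:R.
  by apply: le_trans (ltW (archi_boundP K0)) _; rewrite ler_nat leq_maxr.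
pose x j := (x0 * 2 ^ j)%N.
exists ((x0 ^ (2 * q))%:R + 2 ^+ (2 * q).+2) => [|d Omega P n m M gM m0 mn qnm qn].
  by rewrite ltr_wpDl// exprn_gt0.
have xx0 j : (x0 <= x j)%N by rewrite leq_pmulr// expn_gt0.
have x2 j : (2 <= x j)%N by exact: leq_trans (xx0 j).
have xK j : tail_const c C <= (x j)%:R by rewrite (le_trans x0K)// ler_nat.
have /choice [E HE] j := condition_event c0 C0 gM m0 mn q0 qnm (x2 j) (xK j).
have mE j : measurable (E j) by case: (HE j).
pose T j w : \bar R := (((2 * x j) ^ (2 * q))%:R * \1_(E j) w)%:E.
have T0 j w : (0 <= T j w)%E by rewrite lee_fin mulr_ge0.
have mT j : measurable_fun setT (T j).
  by apply/measurable_EFinP; exact: measurable_funM.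
pose S w := (\sum_(0 <= j <oo) T j w)%E.
have S0 w : (0 <= S w)%E by apply: nneseries_ge0 => j _ _.
have mS : measurable_fun setT S by exact: ge0_emeasurable_sum.
exists (fun w => ((x0 ^ (2 * q))%:R%:E + S w)%E); split.
- exact: emeasurable_funD.
- by move=> w; rewrite adde_ge0// lee_fin.
- rewrite ge0_integralD// integral_cst// (_ : _ setT = 1%E) ?mule1; last first.
    exact: probability_setT.
  rewrite EFinD leeD2l// integral_nneseries//.
  apply: lime_le; first by apply: is_cvg_nneseries => j _ _; exact: integral_ge0.
  apply: nearW => k.
  have ET j : (\int[P]_w T j w <= (2 ^+ (2 * q).+1 / 2 ^+ j)%:E)%E.
    rewrite /T; under eq_integral do rewrite EFinM.
    rewrite ge0_integralZl_EFin//; last exact/measurable_EFinP.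
    rewrite integral_indic// setIT.
    have [_ PE _] := HE j; apply: le_trans (lee_wpmul2l _ PE) _ => //.
    have xj0 : 0 < (x j)%:R :> R by rewrite ltr0n (leq_trans _ (x2 j)).
    rewrite -EFinM lee_fin expnMn natrM natrX -[leLHS]mulrA exprSr -[leRHS]mulrA.
    rewrite ler_wpM2l ?exprn_ge0// mulrCA ler_pM2l//.
    rewrite ler_pdivrMr ?exprn_gt0// mulrC ler_pdivlMr ?exprn_gt0//.
    rewrite -!natrX -natrM ler_nat.
    apply: (@leq_trans (x j ^ (2 * q).+1)); last by rewrite leq_pexp2l// (leq_trans _ (x2 j)).
    by rewrite expnSr leq_mul2l leq_pmull ?orbT// (leq_trans _ x02).
  apply: (@le_trans _ _ (2 ^+ (2 * q).+2 * (1 - 2 ^- k))%:E); last first.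
    rewrite lee_fin ler_piMr ?exprn_ge0// lerBlDr lerDl invr_ge0 exprn_ge0//.
  elim: k => [|k IH].
    by rewrite big_nil lee_fin expr0 invr1 subrr mulr0.
  rewrite big_nat_recr//=; apply: le_trans (leeD IH (ET k)) _.
  rewrite -EFinD lee_fin [_ ^+ (2 * q).+2]exprSr (exprSr _ k) le_eqVlt; apply/orP; left.
  by apply/eqP; field; rewrite expf_neq0.
- move=> w lam mu mu0 ep.
  have lam0 : 0 <= lam.
    by have [Mlam [u u1 _] _] := ep; have := Mlam u; rewrite u1 mulr1 => /(le_trans (sqn_ge0 _)).
  have xe j : (2 ^ j <= x j ^ (2 * q))%N.
    rewrite (@leq_trans (x j))//; first by rewrite leq_pmull// (leq_trans _ x02).
    by rewrite -[leqLHS]expn1 leq_pexp2l ?(leq_trans _ (x2 j))// muln_gt0 q0.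
  have ex : exists j, lam / mu <= (x j ^ (2 * q))%:R.
    exists (Num.bound (lam / mu)).
    have lm0 : 0 <= lam / mu by rewrite divr_ge0// ltW.
    apply: le_trans (ltW (archi_boundP lm0)) _.
    by rewrite ler_nat (leq_trans _ (xe _))// ltnW// ltn_expl.
  case: (ex_minnP ex) => -[|j] jle jmin.
    rewrite (@le_trans _ _ (x0 ^ (2 * q))%:R%:E)//.
      by rewrite lee_fin (le_trans jle)// /x expn0 muln1.
    by rewrite leeDl.
  have jlt : (x j ^ (2 * q))%:R < lam / mu.
    by rewrite ltNge; apply/negP => /jmin; rewrite ltnn.
  have Ew : E j w.
    have [_ _ HEj] := HE j; apply: (HEj w lam mu) => //.
      rewrite lt_neqAle lam0 andbT eq_sym; apply/eqP => l0.
      by move: jlt; rewrite l0 mul0r ltNge ler0n.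
    by rewrite mulrC -natrX -ler_pdivlMr// ltW.
  apply: (@le_trans _ _ (T j w)).
    rewrite lee_fin indicE mem_set// mulr1 (le_trans jle)// ler_nat.
    by rewrite /x expnS mulnCA.
  apply: (@le_trans _ _ (S w)); last by rewrite leeDr// lee_fin.
  have := @nneseries_lim_ge R (T ^~ w) xpredT 0 j.+1 (fun i _ _ => T0 i w).
  apply: le_trans.
  by rewrite big_nat_recr//= leeDr// sume_ge0.
Qed.

(** * Spectral theorem for real symmetric matrices *)

Lemma char_poly_conj (F : fieldType) n (P D : 'M[F]_n) : P \in unitmx ->
  char_poly (invmx P *m D *m P) = char_poly D.
Proof.
move=> Pu; rewrite /char_poly.
have -> : char_poly_mx (invmx P *m D *m P) =
    map_mx polyC (invmx P) *m char_poly_mx D *m map_mx polyC P.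
  rewrite /char_poly_mx mulmxBr mulmxBl -!map_mxM; congr (_ - _).
  rewrite scalar_mxC -mulmxA -map_mxM mulVmx// map_mx1.
  by rewrite mulmx1.
rewrite !det_mulmx mulrAC -det_mulmx -map_mxM mulVmx//.
by rewrite map_mx1 det1 mul1r.
Qed.

Lemma conj_sqr (F : fieldType) n (P D : 'M[F]_n) : P \in unitmx ->
  invmx P *m D *m P *m (invmx P *m D *m P) = invmx P *m (D *m D) *m P.
Proof. by move=> Pu; rewrite !mulmxA mulmxK. Qed.

Lemma rank_diag_le (F : fieldType) n (d : 'rV[F]_n) :
  (\rank (diag_mx d) <= #|[pred k | d ord0 k != 0%R]|)%N.
Proof.
have -> : diag_mx d = \sum_k d 0 k *: delta_mx k k.
  apply/matrixP => i j; rewrite mxE summxE (bigD1 i)//= !mxE eqxx/= big1 => [|k ki].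
    by rewrite addr0 eq_sym; case: eqP; rewrite ?mulr1 ?mulr0.
  by rewrite !mxE eq_sym (negbTE ki) mulr0.
apply: (@leq_trans (\sum_k \rank (d ord0 k *: (delta_mx k k : 'M[F]_n)))).
  elim/big_rec2: _ => [|k r B _ rB]; first by rewrite mxrank0.
  by apply: leq_trans (mxrank_add _ _) _; rewrite leq_add2l.
rewrite -sum1_card [leqRHS]big_mkcond/=; apply: leq_sum => k _.
rewrite inE; case: eqP => [->|_] /=; first by rewrite scale0r mxrank0.
by apply: leq_trans (mxrank_scale _ _) _; rewrite mxrank_delta.
Qed.

(** The upper bound holds for [d] and for the indicator of its zeros, and the sum of
    the two diagonal matrices is invertible. *)
Lemma rank_diag (F : fieldType) n (d : 'rV[F]_n) :
  \rank (diag_mx d) = #|[pred k | d ord0 k != 0%R]|%N.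
Proof.
apply/eqP; rewrite eqn_leq rank_diag_le/=.
pose e : 'rV[F]_n := \row_k (d ord0 k == 0)%:R.
have DE : \rank (diag_mx d + diag_mx e)%R = n.
  have -> : diag_mx d + diag_mx e = diag_mx (d + e).
    by apply/matrixP => i j; rewrite !mxE mulrnDl.
  apply: mxrank_unit; rewrite unitmxE det_diag unitfE.
  apply/prodf_neq0 => k _; rewrite !mxE.
  by case: (eqVneq (d 0 k) 0) => [->|d0]; rewrite ?add0r ?oner_neq0 ?addr0.
have := mxrank_add (diag_mx d) (diag_mx e); rewrite DE.
have re := rank_diag_le e.
have eE : #|[pred k | e ord0 k != 0]| = #|[predC [pred k | d ord0 k != 0]]|.
  apply: eq_card => k; rewrite !inE /e mxE negbK.
  by have [_|_] := boolP (d ord0 k == 0); rewrite ?eqxx ?oner_eq0.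
rewrite {}eE in re.
have := cardC [pred k | d ord0 k != 0]; rewrite card_ord => dC h.
by rewrite -(leq_add2r #|[predC [pred k | d ord0 k != 0]]|) dC (leq_trans h)// leq_add2l.
Qed.

Section real_spectrum.
Context {R : realType}.
Local Notation C := R[i].
Local Notation toC := (real_complex R).
Local Notation conjC := (@Num.conj C).

Lemma quad_sqn n (A : 'M[R]_n) (e : 'cV[R]_n) : A^T = A ->
  sqn (A *m e) = (e^T *m (A *m A) *m e) 0 0.
Proof.
move=> At.
have -> : e^T *m (A *m A) *m e = (A *m e)^T *m (A *m e).
  by rewrite trmx_mul At !mulmxA.
rewrite mxE.
by apply: eq_bigr => i _; rewrite [(_^T) _ _]mxE expr2.
Qed.

(** Unitary diagonalisation over [R[i]]: [l] are the eigenvalues, real because the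
    matrix is Hermitian, and [r k = |(P e)_k|^2] for the diagonalising matrix [P]. Only
    real data are returned, which reduces every inequality between quadratic forms of
    [A] to one between numbers [l k]. *)
Lemma real_spectral n (A : 'M[R]_n) : A^T = A ->
  exists l : 'I_n -> R,
  [/\ char_poly A = \prod_k ('X - (l k)%:P),
      \rank A = #|[pred k | l k != 0]| &
      forall e : 'cV[R]_n, exists r : 'I_n -> R,
      [/\ forall k, 0 <= r k, sqn e = \sum_k r k,
         (e^T *m A *m e) 0 0 = \sum_k l k * r k &
         sqn (A *m e) = \sum_k l k ^+ 2 * r k]].
Proof.
move=> At; pose B := map_mx toC A.
have BR : B \is a mxOver Num.real.
  by apply/mxOverP => i j; rewrite mxE complex_real.
have BH : B \is hermsymmx.
  apply: realsym_hermsym => //.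
  apply/is_hermitianmxP; rewrite expr0 scale1r map_mx_id// /B map_trmx At.
  by [].
have BN : B \is normalmx by exact: hermitian_normalmx.
have /orthomx_spectralP := BN.
set P := spectralmx B; set sp := spectral_diag B => BE.
have spR : sp \is a mxOver Num.real by exact: hermitian_spectral_diag_real.
pose l k := complex.Re (sp 0 k).
have lE k : toC (l k) = sp 0 k by rewrite /= RRe_real//; exact: (mxOverP spR).
have Pu : P \in unitmx by exact: spectral_unit.
exists l; split.
- apply: (@map_poly_inj _ _ toC).
  rewrite map_char_poly -/B BE char_poly_conj// char_poly_trig ?diag_mx_is_trig//.
  rewrite rmorph_prod/=; apply: eq_bigr => k _.
  by rewrite rmorphB/= map_polyX map_polyC mxE eqxx mulr1n -lE.
- rewrite -(mxrank_map toC) -/B BE mxrankMfree ?row_free_unit//.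
  rewrite eqmxMfull ?row_full_unit ?unitmx_inv// rank_diag.
  by apply: eq_card => k; rewrite !inE -lE fmorph_eq0.
- move=> e; pose eC := map_mx toC e; pose q := P *m eC.
  pose r k := complex.Re (q k 0 * conjC (q k 0)).
  have rE k : toC (r k) = q k 0 * conjC (q k 0).
    by rewrite /= RRe_real// ger0_real// mul_conjC_ge0.
  have r0 k : 0 <= r k.
    by have := mul_conjC_ge0 (q k 0); rewrite -rE /= lecR.
  have quad (dd : 'rV[C]_n) : (eC^T *m (invmx P *m diag_mx dd *m P) *m eC) 0 0 =
      \sum_k dd 0 k * toC (r k).
    have -> : eC^T *m (invmx P *m diag_mx dd *m P) *m eC =
        (eC^T *m invmx P) *m (diag_mx dd *m q) by rewrite /q !mulmxA.
    have -> : eC^T *m invmx P = map_mx conjC q^T.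
      rewrite invmx_unitary ?spectral_unitarymx// /q trmx_mul map_mxM; congr (_ *m _).
      apply/matrixP => i j; rewrite !mxE; apply/esym/CrealP.
      by rewrite complex_real.
    rewrite mxE; apply: eq_bigr => k _; rewrite mul_diag_mx !mxE rE.
    by rewrite mulrCA [conjC _ * _]mulrC /q mxE.
  have toCq (F : 'M[R]_n) : toC ((e^T *m F *m e) 0 0) =
      (eC^T *m map_mx toC F *m eC) 0 0.
    have -> : eC^T = map_mx toC e^T by apply/matrixP => i j; rewrite !mxE.
    by rewrite /eC -!map_mxM [RHS]mxE.
  exists r; split=> //; apply: (fmorph_inj toC).
  + transitivity (toC ((e^T *m 1%:M *m e) 0 0)).
      congr (toC _); rewrite mulmx1 mxE; apply: eq_bigr => i _.
      by rewrite mxE expr2.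
    rewrite toCq map_mx1 -(mulVmx Pu) -[X in _ *m (X *m P)]mulmx1.
    rewrite -(diag_const_mx _ 1) quad rmorph_sum.
    by apply: eq_bigr => k _; rewrite mxE mul1r.
  + rewrite -[LHS]/(toC _) -[RHS]/(toC _) toCq -/B BE quad rmorph_sum.
    apply: eq_bigr => k _.
    by rewrite rmorphM/= -lE.
  + rewrite -[LHS]/(toC _) -[RHS]/(toC _) (quad_sqn _ At) toCq map_mxM -/B.
    have BB := conj_sqr (diag_mx sp) Pu; rewrite -BE mulmx_diag in BB.
    rewrite BB quad rmorph_sum; apply: eq_bigr => k _.
    by rewrite mxE -lE rmorphM rmorphXn expr2.
Qed.

End real_spectrum.

(** * Spectrum of the Gram matrix *)

Section eigenvalues.
Context {R : realType}.

Lemma ge_trans : transitive (>=%R : rel R).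
Proof. by move=> y x z /= yx zy; exact: le_trans zy yx. Qed.

Lemma sorted_ge_nth (s : seq R) i j : sorted >=%R s -> (i <= j)%N ->
  (j < size s)%N -> s`_j <= s`_i.
Proof.
move=> ss ij js; have is_ := leq_ltn_trans ij js.
have rr : reflexive (>=%R : rel R) by move=> x; exact: lexx.
by apply: (sorted_leq_nth ge_trans rr 0 ss i j) ij; rewrite inE.
Qed.

Lemma nth0_of_count (s : seq R) i : sorted >=%R s -> (forall a, a \in s -> 0 <= a) ->
  (count (predC1 (0 : R)%R) s <= i)%N -> s`_i = 0.
Proof.
move=> ss s0 ci; have [si|si] := leqP (size s) i; first by rewrite nth_default.
apply/eqP/contraT => ai.
have : (i.+1 <= count (predC1 (0 : R)%R) s)%N.
  rewrite -[s](cat_take_drop i.+1) count_cat.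
  have : all (predC1 (0 : R)%R) (take i.+1 s).
    apply/(all_nthP 0) => j; rewrite size_takel// => ji /=.
    rewrite nth_take// gt_eqF// (lt_le_trans _ (sorted_ge_nth ss _ si))//.
    by rewrite lt_neqAle eq_sym ai s0// mem_nth.
  by rewrite all_count => /eqP ->; rewrite size_takel// leq_addr.
by move/leq_trans => /(_ _ ci); rewrite ltnn.
Qed.

Lemma count_of_nth0 (s : seq R) i : sorted >=%R s -> (forall a, a \in s -> 0 <= a) ->
  s`_i = 0 -> (count (predC1 (0 : R)%R) s <= i)%N.
Proof.
move=> ss s0 si; rewrite -[s](cat_take_drop i) count_cat.
have /eqP -> : count (predC1 (0 : R)%R) (drop i s) == 0%N.
  rewrite -leqn0 leqNgt -has_count; apply/hasPn => a /(nthP 0)[j].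
  rewrite size_drop nth_drop => js <- /=.
  have ijs : (i + j < size s)%N by rewrite -ltn_subRL.
  rewrite negbK eq_le s0 ?mem_nth// andbT.
  by have := sorted_ge_nth ss (leq_addr j i) ijs; rewrite si.
rewrite addn0 (leq_trans (count_size _ _))// size_take.
by case: ltnP.
Qed.

(** The characteristic polynomial determines its roots up to permutation, so the
    list is the sorted family of [real_spectral]. *)
Lemma eigenvalues_descP n (A : 'M[R]_n) (s := eigenvalues_desc A) : A^T = A ->
  [/\ sorted >=%R s, char_poly A = \prod_(a <- s) ('X - a%:P), size s = n,
      \rank A = count (predC1 (0 : R)%R) s &
      forall e : 'cV[R]_n, exists (l r : 'I_n -> R),
      [/\ forall k, l k \in s, forall k, 0 <= r k, sqn e = \sum_k r k,
         (e^T *m A *m e) 0 0 = \sum_k l k * r k &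
         sqn (A *m e) = \sum_k l k ^+ 2 * r k]].
Proof.
move=> At; have [l [lA rA lE]] := real_spectral At.
pose t := sort >=%R (codom l).
have lt : char_poly A = \prod_(a <- t) ('X - a%:P).
  rewrite lA (perm_big (codom l)) ?perm_sort//=.
  by rewrite /codom /image_mem big_map enumT.
have : (sorted >=%R s /\ char_poly A = \prod_(a <- s) ('X - a%:P)).
  rewrite /s /eigenvalues_desc; case: xgetP => [y -> //|/(_ t) []].
  by split => //; apply: sort_sorted; move=> x y; exact: le_total.
move=> [ss sA].
have st : perm_eq s (codom l).
  apply: perm_trans (_ : perm_eq t _); last by rewrite perm_sort.
  by apply: prod_XsubC_eq; rewrite -sA -lt.
split => //.
- by rewrite (perm_size st) size_codom card_ord.
- rewrite rA (permP st) /codom /image_mem count_map cardE /enum_mem size_filter.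
  by rewrite filter_predT; apply: eq_count => k; rewrite !inE.
- move=> e; have [r [r0 e0 e1 e2]] := lE e; exists l, r; split=> // k.
  by rewrite (perm_mem st) codom_f.
Qed.

Lemma eigenvector n (A : 'M[R]_n) a : A^T = A -> a \in eigenvalues_desc A ->
  exists2 u : 'cV[R]_n, sqn u = 1 & A *m u = a *: u.
Proof.
move=> At aA; have [_ cA _ _ _] := eigenvalues_descP At.
have : eigenvalue A a by rewrite eigenvalue_root_char cA root_prod_XsubC.
move=> /eigenvalueP[v vA v0].
have s0 : 0 < sqn v^T.
  rewrite lt_neqAle sqn_ge0 andbT eq_sym psumr_eq0; last by move=> i _; exact: sqr_ge0.
  apply: contra v0 => /allP H; apply/eqP/rowP => j.
  by have := H j (mem_index_enum j); rewrite !mxE/= sqrf_eq0 => /eqP.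
exists ((Num.sqrt (sqn v^T))^-1 *: v^T).
  by rewrite sqnZ exprVn sqr_sqrtr ?mulVf ?gt_eqF// ltW.
by rewrite -scalemxAr -{1}At -trmx_mul vA linearZ/= !scalerA mulrC.
Qed.

Section gram.
Variables (n p : nat) (X : 'M[R]_(n, p)).
Hypotheses (n0 : (0 < n)%N) (p0 : (0 < p)%N).
Let A := X^T *m X.
Let s := eigenvalues_desc A.
Let m := minn n p.
Let lam := s`_0.
Let mu := s`_m.-1.

Lemma gram_sym : A^T = A.
Proof. by rewrite trmx_mul trmxK. Qed.

Lemma gram_quad e : (e^T *m A *m e) 0 0 = sqn (X *m e).
Proof.
have -> : e^T *m A *m e = (X *m e)^T *m (X *m e) by rewrite trmx_mul !mulmxA.
by rewrite mxE; apply: eq_bigr => i _; rewrite mxE expr2.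
Qed.

Let ssz : size s = p. Proof. by case: (eigenvalues_descP gram_sym). Qed.
Let ss : sorted >=%R s. Proof. by case: (eigenvalues_descP gram_sym). Qed.
Let rk : \rank A = count (predC1 (0 : R)%R) s.
Proof. by case: (eigenvalues_descP gram_sym). Qed.

Let m0 : (0 < m)%N. Proof. by rewrite leq_min n0. Qed.
Let mp : (m.-1 < p)%N. Proof. by rewrite prednK// geq_minr. Qed.

Lemma gram_ge0 a : a \in s -> 0 <= a.
Proof.
move=> /(eigenvector gram_sym)[u u1 Au].
have := gram_quad u; rewrite -mulmxA Au -scalemxAr mxE.
have -> : (u^T *m u) 0 0 = 1.
  by rewrite -u1 mxE; apply: eq_bigr => i _; rewrite mxE expr2.
by rewrite mulr1 => ->; exact: sqn_ge0.
Qed.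

Lemma lam_mem : lam \in s. Proof. by rewrite mem_nth// ssz. Qed.
Lemma mu_mem : mu \in s. Proof. by rewrite mem_nth// ssz. Qed.

Lemma mu_ge0 : 0 <= mu. Proof. exact/gram_ge0/mu_mem. Qed.

Lemma lam_max a : a \in s -> a <= lam.
Proof. by move=> /(nthP 0)[i is_ <-]; apply: sorted_ge_nth. Qed.

Lemma mu_le_lam : mu <= lam. Proof. exact/lam_max/mu_mem. Qed.

(** The rank of [A] is at most [minn n p], so the sorted eigenvalues vanish from
    that index on. *)
Lemma gram_zero_or_ge a : a \in s -> a = 0 \/ mu <= a.
Proof.
move=> /(nthP 0)[i is_ <-]; have [im|im] := ltnP i m.
  by right; apply: sorted_ge_nth => //; rewrite ?ssz// -ltnS prednK.
left; apply: nth0_of_count => //; first exact: gram_ge0.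
rewrite -rk (leq_trans _ im)// /m leq_min.
by rewrite (leq_trans (mxrankM_maxr _ _) (rank_leq_row _)) rank_leq_col.
Qed.

Lemma gram_upper (e : 'cV[R]_p) : sqn (X *m e) <= lam * sqn e.
Proof.
have [_ _ _ _ /(_ e)[l [r [ls r0 e0 e1 _]]]] := eigenvalues_descP gram_sym.
rewrite -gram_quad e1 e0 mulr_sumr; apply: ler_sum => k _.
by rewrite ler_wpM2r// lam_max.
Qed.

(** An eigenvalue [a] enters the left-hand side with weight [mu a] and the
    right-hand side with weight [a^2]; it is either 0 or at least [mu]. *)
Lemma gram_lower (e : 'cV[R]_p) : mu * sqn (X *m e) <= sqn (A *m e).
Proof.
have [_ _ _ _ /(_ e)[l [r [ls r0 _ e1 e2]]]] := eigenvalues_descP gram_sym.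
rewrite -gram_quad e1 e2 mulr_sumr; apply: ler_sum => k _.
rewrite expr2 mulrA ler_wpM2r//.
have [->|h] := gram_zero_or_ge (ls k); first by rewrite !mulr0.
by rewrite ler_wpM2r// gram_ge0.
Qed.

Lemma gram_eigen_sqn (u : 'cV[R]_p) a : sqn u = 1 -> A *m u = a *: u -> sqn (X *m u) = a.
Proof.
move=> u1 Au; rewrite -gram_quad -mulmxA Au -scalemxAr mxE.
have -> : (u^T *m u) 0 0 = 1.
  by rewrite -u1 mxE; apply: eq_bigr => i _; rewrite mxE expr2.
by rewrite mulr1.
Qed.

Lemma gram_inj (e : 'cV[R]_p) : (p <= n)%N -> 0 < mu -> X *m e = 0 -> e = 0.
Proof.
move=> pn mu0 Xe; apply: sqn_eq0.
have [_ _ _ _ /(_ e)[l [r [ls r0 e0 e1 _]]]] := eigenvalues_descP gram_sym.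
have : mu * sqn e <= sqn (X *m e).
  rewrite -gram_quad e1 e0 mulr_sumr; apply: ler_sum => k _.
  rewrite ler_wpM2r//.
  have /(nthP 0)[i is_ <-] := ls k.
  apply: sorted_ge_nth => //; rewrite ?ssz// -ltnS prednK//.
  by rewrite /m (minn_idPr pn) -ssz.
rewrite Xe [X in _ <= X]big1 => [|i _]; last by rewrite mxE expr0n.
rewrite pmulr_rle0// => h; apply/eqP; by rewrite eq_le h sqn_ge0.
Qed.

Lemma gram_row_free : (n <= p)%N -> 0 < mu -> row_free X.
Proof.
move=> np mu0; rewrite /row_free eqn_leq rank_leq_row/=.
apply: leq_trans (mxrankM_maxr X^T X); rewrite -/A rk leqNgt; apply/negP => h.
have : mu = 0.
  apply: nth0_of_count => //; first exact: gram_ge0.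
  by rewrite -ltnS prednK// /m (minn_idPl np).
by move=> mE; rewrite mE ltxx in mu0.
Qed.

Lemma mu_gt0_tall : (p <= n)%N -> (forall e : 'cV[R]_p, X *m e = 0 -> e = 0) -> 0 < mu.
Proof.
move=> pn Xinj; rewrite lt_neqAle mu_ge0 andbT eq_sym; apply/eqP => mE.
have [u u1 Au] := eigenvector gram_sym mu_mem.
have := gram_eigen_sqn u1 Au; rewrite mE => /sqn_eq0/Xinj u0.
have : sqn u = 0 by rewrite u0 /sqn big1// => i _; rewrite mxE expr0n.
by rewrite u1 => /eqP; rewrite oner_eq0.
Qed.

(** The rank of [X^T X] is that of [X], here [n], so there are [n] nonzero
    eigenvalues. *)
Lemma mu_gt0_wide : (n <= p)%N -> (forall e : 'cV[R]_n, X^T *m e = 0 -> e = 0) -> 0 < mu.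
Proof.
move=> np Xinj; rewrite lt_neqAle mu_ge0 andbT eq_sym; apply/eqP => mE.
have Xf : row_free X.
  apply: inj_row_free => v vX; apply: trmx_inj; rewrite trmx0; apply: Xinj.
  by rewrite -trmx_mul vX trmx0.
have : \rank A = n by rewrite mxrankMfree// mxrank_tr; exact/eqP.
have := count_of_nth0 ss gram_ge0 mE; rewrite -rk => /[swap] -> .
by rewrite /m (minn_idPl np) leqNgt prednK ?leqnn.
Qed.

End gram.
End eigenvalues.

(** * Contraction of gradient descent *)

Section gradient_descent.
Context {R : realType}.
Variables (n p : nat) (X : 'M[R]_(n, p)).
Hypotheses (n0 : (0 < n)%N) (p0 : (0 < p)%N).
Local Notation A := (X^T *m X).
Local Notation s := (eigenvalues_desc A).
Local Notation lam := (s`_0).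
Local Notation mu := (s`_(minn n p).-1).
Local Notation S := (sample_cov X).
Hypothesis mu0 : 0 < mu.

Let nR : 0 < n%:R :> R. Proof. by rewrite ltr0n. Qed.

Let lam0 : 0 < lam. Proof. exact: lt_le_trans mu0 (mu_le_lam _ n0 p0). Qed.

Lemma kappa_sqr : kappa X ^+ 2 = lam / mu.
Proof.
rewrite /kappa /s_max /s_min /singular_value expr_div_n !sqr_sqrtr//.
  exact: ltW.
exact: ltW.
Qed.

Lemma step_sizeE : step_size X = n%:R / lam.
Proof.
have As : A^T = A by exact: gram_sym.
have eigA a : eigenvalue A a = (a \in s).
  by have [_ cA _ _ _] := eigenvalues_descP As; rewrite eigenvalue_root_char cA root_prod_XsubC.
have eigS a : eigenvalue S a = (n%:R * a \in s).
  rewrite -eigA; apply/eigenvalueP/eigenvalueP => -[v vS v0]; exists v => //.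
    rewrite -scalerA -vS /sample_cov -scalemxAr scalerA mulfV ?gt_eqF// scale1r//.
  by rewrite /sample_cov -scalemxAr vS scalerA mulKf// gt_eqF.
have lamS : eigenvalue S (lam / n%:R).
  by rewrite eigS mulrC divfK ?gt_eqF//; exact: lam_mem.
have ubS : ubound [set a | eigenvalue S a] (lam / n%:R).
  move=> a /=; rewrite eigS => /(lam_max) h.
  by rewrite ler_pdivlMr// mulrC h.
rewrite /step_size (_ : lambda_max S = lam / n%:R) ?invf_div//.
apply/eqP; rewrite eq_le; apply/andP; split.
  by apply: ge_sup => //; exists (lam / n%:R).
by apply: ub_le_sup => //; exists (lam / n%:R).
Qed.

Lemma gram_unit : (p <= n)%N -> A \in unitmx.
Proof.
move=> pn; rewrite -row_free_unit; apply: inj_row_free => v vA.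
apply: trmx_inj; rewrite trmx0; apply: (gram_inj n0 p0 pn mu0); apply: sqn_eq0.
by rewrite -gram_quad trmxK vA mul0mx mxE.
Qed.

Lemma gram_tr_unit : (n <= p)%N -> X *m X^T \in unitmx.
Proof.
move=> np; have Xf := gram_row_free n0 p0 np mu0.
rewrite -row_free_unit; apply: inj_row_free => v vX.
have /sqn_eq0 h : sqn ((v *m X)^T) = 0.
  rewrite /sqn; transitivity ((v *m (X *m X^T) *m v^T) 0 0); last first.
    by rewrite vX mul0mx mxE.
  rewrite -[v *m (X *m X^T) *m v^T]mulmxA -mulmxA -trmx_mul mulmxA mxE.
  by apply: eq_bigr => i _; rewrite [(_^T) _ _]mxE expr2.
by apply: (row_free_inj Xf); rewrite mul0mx; apply: trmx_inj; rewrite h trmx0.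
Qed.

(** For [p > n] the vector [b] lies in the range of [X^T], which is that of [S], and
    [S S^+ S = S]. *)
Lemma sample_cov_optimum b : col_range X^T b -> S *m optimum X b = b.
Proof.
move=> [u _ ub]; rewrite /optimum; case: leqP => [pn|/ltnW np].
  rewrite mulKVmx// unitmxE detZ unitrM -unitmxE gram_unit// andbT.
  by rewrite unitfE expf_neq0// invr_eq0 gt_eqF.
have Gu := gram_tr_unit np.
set G := X *m X^T in Gu *; set H := invmx G.
have HT : H^T = H by rewrite /H trmx_inv /G trmx_mul trmxK.
have GH : G *m H = 1%:M by rewrite mulmxV.
have HG : H *m G = 1%:M by rewrite mulVmx.
(* [Q] is the orthogonal projection onto the row space of [X]. *)
pose Q := X^T *m H *m X.
have QT : Q^T = Q by rewrite /Q !trmx_mul trmxK HT mulmxA.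
(* A Moore-Penrose inverse of [S], which shows that there is one to choose. *)
pose B0 := n%:R *: (X^T *m H *m H *m X).
have SB0 : S *m B0 = Q.
  rewrite /S /B0 /sample_cov -scalemxAl -scalemxAr scalerA mulVf ?gt_eqF// scale1r.
  rewrite /Q !mulmxA -[X^T *m X *m X^T]mulmxA -/G.
  by rewrite -[X^T *m G *m H]mulmxA GH mulmx1.
have B0S : B0 *m S = Q.
  rewrite /S /B0 /sample_cov -scalemxAl -scalemxAr scalerA mulfV ?gt_eqF// scale1r.
  rewrite /Q !mulmxA -[_ *m X *m X^T]mulmxA -/G.
  by rewrite -[_ *m H *m G]mulmxA HG mulmx1.
have QX : Q *m X^T = X^T by rewrite /Q -mulmxA -/G -mulmxA HG mulmx1.
have QS : Q *m S = S by rewrite /sample_cov -scalemxAr mulmxA QX.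
have MP : is_moore_penrose S B0.
  split; rewrite ?SB0 ?B0S//.
  by rewrite /B0 -scalemxAr !mulmxA QX.
have [SBS _ _ _] : is_moore_penrose S (moore_penrose S).
  by rewrite /moore_penrose; case: xgetP => [B -> //|/(_ B0)].
have -> : b = S *m (B0 *m b).
  by rewrite mulmxA SB0 -ub mulmxA QX.
by rewrite !mulmxA SBS.
Qed.

Lemma objective_gap b th t0 : S *m t0 = b ->
  objective X b th - objective X b t0 = (2 * n%:R)^-1 * sqn (X *m (th - t0)).
Proof.
move=> Sb; have ST : S^T = S by rewrite /sample_cov linearZ/= gram_sym.
set e := th - t0.
have -> : (2 * n%:R)^-1 * sqn (X *m e) = 2^-1 * (e^T *m S *m e) 0 0.
  by rewrite /sample_cov -scalemxAr -scalemxAl [in RHS]mxE gram_quad invfM mulrA.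
have thE : th = t0 + e by rewrite addrC subrK.
clearbody e.
have tD : (t0 + e)^T = t0^T + e^T by rewrite linearD.
have bT : b^T = t0^T *m S by rewrite -Sb trmx_mul ST.
have sw : (e^T *m S *m t0) 0 0 = (t0^T *m S *m e) 0 0.
  have -> : e^T *m S *m t0 = (t0^T *m S *m e)^T by rewrite !trmx_mul trmxK ST mulmxA.
  by rewrite mxE.
have mD (x y : 'M[R]_1) : (x + y) 0 0 = x 0 0 + y 0 0 by rewrite mxE.
rewrite /objective bT thE tD !(mulmxDl, mulmxDr) !mD.
by rewrite sw; field.
Qed.

(** With [g = A e], expanding the square leaves
    [|X e|^2 - 2 |g|^2 / lam + |X g|^2 / lam^2 <= |X e|^2 - |g|^2 / lam], and
    [|g|^2 >= mu |X e|^2] by [gram_lower] (a Polyak-Lojasiewicz inequality). *)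
Lemma gd_step (e : 'cV[R]_p) :
  sqn (X *m (e - step_size X *: (S *m e))) <= (1 - mu / lam) * sqn (X *m e).
Proof.
have -> : step_size X *: (S *m e) = lam^-1 *: (A *m e).
  rewrite step_sizeE /sample_cov -scalemxAl scalerA mulrAC divff ?mul1r//.
  by rewrite gt_eqF.
rewrite mulmxBr -scalemxAr; set g := A *m e.
have dot : \sum_i (X *m e) i 0 * (X *m g) i 0 = sqn g.
  rewrite /g (quad_sqn _ (gram_sym X)).
  transitivity (((X *m e)^T *m (X *m g)) 0 0).
    by rewrite mxE; apply: eq_bigr => i _; rewrite [(_^T) _ _]mxE.
  by rewrite trmx_mul !mulmxA.
have -> : sqn (X *m e - lam^-1 *: (X *m g)) =
    sqn (X *m e) - 2 * lam^-1 * sqn g + lam ^- 2 * sqn (X *m g).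
  rewrite -dot /sqn !mulr_sumr -sumrB -big_split/=; apply: eq_bigr => i _.
  have -> : (X *m e - lam^-1 *: (X *m g)) i 0 = (X *m e) i 0 - lam^-1 * (X *m g) i 0.
    by rewrite !mxE.
  by rewrite -exprVn; ring.
have h1 : lam ^- 2 * sqn (X *m g) <= lam^-1 * sqn g.
  rewrite -exprVn expr2 -mulrA ler_pM2l ?invr_gt0// ler_pdivrMl//.
  exact: gram_upper.
have h2 : mu / lam * sqn (X *m e) <= lam^-1 * sqn g.
  rewrite mulrAC mulrC ler_pM2l ?invr_gt0//; exact: gram_lower.
move: h1 h2; lra.
Qed.

Lemma iteration_complexity_le eps b th0 : 0 < eps < 1 -> col_range X^T b ->
  (iteration_complexity eps X b th0 <= (kappa X ^+ 2 * ln (1 / eps) + 1)%:E)%E.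
Proof.
move=> /andP[e0 e1] bX; have Sb := sample_cov_optimum bX.
set ts := optimum X b in Sb *.
pose rho := 1 - mu / lam.
have rho0 : 0 <= rho by rewrite subr_ge0 ler_pdivrMr// mul1r mu_le_lam.
have decay t : sqn (X *m (gd_iterate X b th0 t - ts)) <= rho ^+ t * sqn (X *m (th0 - ts)).
  elim: t => [|t IH]; first by rewrite expr0 mul1r.
  rewrite exprS -mulrA; apply: le_trans (ler_wpM2l rho0 IH).
  apply: le_trans (gd_step _).
  rewrite /gd_iterate/= -/(gd_iterate X b th0 t) le_eqVlt; apply/orP; left; apply/eqP.
  by congr (sqn (_ *m _)); rewrite mulmxBr Sb addrAC.
pose y := kappa X ^+ 2 * ln (1 / eps).
have y0 : 0 <= y.
  rewrite mulr_ge0 ?sqr_ge0// ln_ge0// div1r invf_ge1// ltW//.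
pose t := (Num.truncn y).+1.
apply: (@le_trans _ _ t%:R%:E).
  apply: ereal_inf_lbound; exists t => //=.
  rewrite -/ts !(objective_gap _ Sb) mulrCA ler_pM2l ?invr_gt0 ?mulr_gt0//.
  apply: le_trans (decay t) _; rewrite ler_wpM2r ?sqn_ge0//.
  have yt : y <= t%:R by have /andP[_ /ltW] := truncn_itv y0.
  apply: (@le_trans _ _ (expR (- (mu / lam)) ^+ t)).
    rewrite lerXn2r ?nnegrE ?expR_ge0//; exact: expR_ge1Dx.
  have epsE : eps = expR (- ln (1 / eps)).
    by rewrite expRN lnK ?posrE ?divr_gt0// div1r invrK.
  rewrite [leRHS]epsE -expRM_natl ler_expR mulrN lerN2.
  have -> : ln (1 / eps) = y * (mu / lam).
    by rewrite /y kappa_sqr; field; rewrite !gt_eqF.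
  by rewrite ler_wpM2r// divr_ge0// ltW.
rewrite lee_fin /t -natr1 lerD2r.
by have /andP[] := truncn_itv y0.
Qed.

End gradient_descent.

(** * Random condition numbers *)

Section extreme_singular_values.
Context {R : realType}.
Variables (n p : nat) (X : 'M[R]_(n, p)).
Hypotheses (n0 : (0 < n)%N) (p0 : (0 < p)%N).
Local Notation s := (eigenvalues_desc (X^T *m X)).
Local Notation lam := (s`_0).
Local Notation mu := (s`_(minn n p).-1).

Lemma extreme_pair_gram : extreme_pair X lam mu.
Proof.
have eig a : a \in s -> exists2 u, sqn u = 1 & sqn (X *m u) = a.
  move=> /(eigenvector (gram_sym X))[u u1 Au]; exists u => //.
  exact: gram_eigen_sqn u1 Au.
split=> [v||]; first exact: gram_upper.
- exact/eig/lam_mem.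
- exact/eig/mu_mem.
Qed.

(** The matrices [X^T X] and [X X^T] share their nonzero eigenvalues: [X u] is an
    eigenvector of the second when [u] is one of the first. *)
Lemma extreme_pair_gram_tr : 0 < mu -> extreme_pair X^T lam mu.
Proof.
move=> mu0; have lam0 : 0 < lam := lt_le_trans mu0 (mu_le_lam X n0 p0).
have eig a : a \in s -> 0 < a -> exists2 u, sqn u = 1 & sqn (X^T *m u) = a.
  move=> /(eigenvector (gram_sym X))[u u1 Au] a0.
  have r2 : (Num.sqrt a)^-1 ^+ 2 = a^-1 by rewrite exprVn sqr_sqrtr// ltW.
  exists ((Num.sqrt a)^-1 *: (X *m u)).
    by rewrite sqnZ r2 (gram_eigen_sqn u1 Au) mulVf// gt_eqF.
  by rewrite -scalemxAr sqnZ r2 mulmxA Au sqnZ u1 mulr1 expr2 mulKf// gt_eqF.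
split=> [v||]; last first.
- exact/eig/mu0/mu_mem.
- exact/eig/lam0/lam_mem.
have dot : \sum_i v i 0 * (X *m (X^T *m v)) i 0 = sqn (X^T *m v).
  transitivity ((v^T *m (X *m (X^T *m v))) 0 0).
    by rewrite [RHS]mxE; apply: eq_bigr => i _; rewrite [in RHS]mxE.
  rewrite mulmxA -[X in v^T *m X]trmxK -trmx_mul mxE.
  by apply: eq_bigr => i _; rewrite [in LHS]mxE expr2.
(* As [|X X^T v|^2 <= lam |X^T v|^2], this square being nonnegative gives
   [|X^T v|^2 <= lam |v|^2]. *)
have : 0 <= sqn (lam *: v - X *m (X^T *m v)) by exact: sqn_ge0.
have -> : sqn (lam *: v - X *m (X^T *m v)) =
    lam * (lam * sqn v) - 2 * (lam * sqn (X^T *m v)) + sqn (X *m (X^T *m v)).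
  rewrite -dot /sqn !mulr_sumr -sumrB -big_split/=; apply: eq_bigr => i _.
  have -> : (lam *: v - X *m (X^T *m v)) i 0 = lam * v i 0 - (X *m (X^T *m v)) i 0.
    by rewrite !mxE.
  by ring.
have h1 := gram_upper X (X^T *m v).
move=> h2; rewrite -(ler_pM2l lam0); move: h1 h2; lra.
Qed.

End extreme_singular_values.

Section rayleigh.
Context {R : realType}.

Lemma rayleigh n (A : 'M[R]_n) : A^T = A -> (0 < n)%N -> forall u : 'cV_n,
  lambda_min A * sqn u <= (u^T *m A *m u) 0 0 <= lambda_max A * sqn u.
Proof.
move=> At n0 u; have [ss cA sz _ /(_ u)[l [r [ls r0 -> -> _]]]] := eigenvalues_descP At.
have eigA a : eigenvalue A a = (a \in eigenvalues_desc A).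
  by rewrite eigenvalue_root_char cA root_prod_XsubC.
set s := eigenvalues_desc A in ss cA sz ls eigA *.
have ub a : a \in s -> a <= s`_0.
  by move=> /(nthP 0)[i is_ <-]; apply: sorted_ge_nth.
have lb a : a \in s -> s`_n.-1 <= a.
  move=> /(nthP 0)[i is_ <-]; apply: sorted_ge_nth => //; rewrite ?sz ?prednK//.
  by rewrite -ltnS prednK// -sz.
rewrite !mulr_sumr; apply/andP; split; apply: ler_sum => k _; rewrite ler_wpM2r//.
  apply: ge_inf; last by rewrite /= eigA ls.
  by exists s`_n.-1 => a /=; rewrite eigA; exact: lb.
apply: ub_le_sup; last by rewrite /= eigA ls.
by exists s`_0 => a /=; rewrite eigA; exact: ub.
Qed.

End rayleigh.

Section random_condition_number.
Context {R : realType}.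

(** Whichever of [X] and [X^T] is tall is almost surely injective. *)
Lemma gaussian_like_gram_gt0 d (Omega : measurableType d) (P : probability Omega R)
    (c C : R) n p (X : Omega -> 'M[R]_(n, p)) :
  0 < c -> (0 < n)%N -> (0 < p)%N -> gaussian_like P c C X ->
  {ae P, forall w, 0 < (eigenvalues_desc ((X w)^T *m X w))`_(minn n p).-1}.
Proof.
move=> c0 n0 p0 gX; have [pn|np] := orP (leq_total p n).
  case: p X p0 gX pn => // p X p0 gX pn.
  apply: filterS (gaussian_like_injective c0 gX pn) => w.
  exact: mu_gt0_tall.
case: n X n0 gX np => // n X n0 gX np.
apply: filterS (gaussian_like_injective c0 (gaussian_like_tr gX) np) => w.
exact: mu_gt0_wide.
Qed.

Lemma kappa_mean (c C : R) (q : nat) : 0 < c -> 0 <= C -> (0 < q)%N ->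
  exists2 K, 0 < K & forall d (Omega : measurableType d) (P : probability Omega R)
    n p (X : Omega -> 'M[R]_(n, p)), gaussian_like P c C X ->
    (0 < n)%N -> (0 < p)%N ->
    (3 * maxn n p <= q * (maxn n p - minn n p))%N -> (2 * q < maxn n p)%N ->
    exists Y : Omega -> \bar R, [/\ measurable_fun setT Y, (forall w, 0 <= Y w)%E,
      (\int[P]_w Y w <= K%:E)%E &
      {ae P, forall w, ((kappa (X w) ^+ 2)%:E <= Y w)%E}].
Proof.
move=> c0 C0 q0; have [K K0 HK] := condition_mean c0 C0 q0; exists K => //.
move=> d Omega P n p X gX n0 p0.
have ae0 := gaussian_like_gram_gt0 c0 n0 p0 gX.
have [pn|np] := orP (leq_total p n).
  rewrite {1 2}(maxn_idPl pn) (minn_idPr pn) => h1; rewrite (maxn_idPl pn) => h2.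
  have [Y [mY Y0 YK YX]] := HK _ _ _ _ _ _ gX p0 pn h1 h2.
  exists Y; split=> //; apply: filterS ae0 => w mu0.
  by rewrite kappa_sqr//; apply: YX => //; exact: extreme_pair_gram.
rewrite (maxn_idPr np) (minn_idPl np) => h1 h2.
have [Y [mY Y0 YK YX]] := HK _ _ _ _ _ _ (gaussian_like_tr gX) n0 np h1 h2.
exists Y; split=> //; apply: filterS ae0 => w mu0.
by rewrite kappa_sqr//; apply: YX => //; exact: extreme_pair_gram_tr.
Qed.

Section nonmeasurable_integrand.
Import HBNNSimple.

(** The integral of [f] is a supremum over the simple functions below [f], and
    these are measurable. *)
Lemma ae_ge0_le_integral_nonmeasurable d (T : measurableType d)
    (mu : {measure set T -> \bar R}) (f g : T -> \bar R) :
  (forall x, 0 <= f x)%E -> measurable_fun setT g -> (forall x, 0 <= g x)%E ->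
  {ae mu, forall x, (f x <= g x)%E} -> (\int[mu]_x f x <= \int[mu]_x g x)%E.
Proof.
move=> f0 mg g0 fg; rewrite ge0_integralTE//; apply: ge_ereal_sup => _ [h hf <-].
rewrite -integralT_nnsfun.
apply: ae_ge0_le_integral => //.
- by move=> x _; rewrite lee_fin; exact: fun_ge0.
- exact/measurable_EFinP.
- by apply: filterS fg => x fgx _; exact: le_trans (hf x) fgx.
Qed.

End nonmeasurable_integrand.

End random_condition_number.

(** * Iteration complexity *)

Lemma gd_setting_gaussian_like (R : realType) (c_m c_M : R) (p : nat -> nat)
    (d : nat -> measure_display) (Omega : forall n, measurableType (d n))
    (P : forall n, probability (Omega n) R) (Sigma : forall n, 'M[R]_(p n))
    (X : forall n, Omega n -> 'M[R]_(n, p n))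
    (b theta0 : forall n, Omega n -> 'cV[R]_(p n)) n :
  gaussian_gd_setting c_m c_M P Sigma X b theta0 -> (0 < n)%N ->
  gaussian_like (P n) c_m c_M (X n).
Proof.
move=> [p0 [cm cM] gX _ _] n0; apply: gaussian_rows_like (gX n n0) => u.
have [l [A [z [_ SA _]]]] := (gX n n0).2 (Ordinal n0).
have St : (Sigma n)^T = Sigma n by rewrite SA trmx_mul trmxK.
have /andP[h1 h2] := rayleigh St (p0 n n0) u.
have cm' : c_m <= lambda_min (Sigma n).
  by rewrite -lee_fin (le_trans cm)//; apply: ereal_inf_lbound; exists n.
have cM' : lambda_max (Sigma n) <= c_M.
  by rewrite -lee_fin (le_trans _ cM)//; apply: ereal_sup_ubound; exists n.
by rewrite (le_trans _ h1) ?(le_trans h2)// ler_wpM2r ?sqn_ge0.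
Qed.

(** With [e = |gamma - 1| / 2], eventually [|p - n| >= e n] while
    [maxn n p <= (gamma + e + 1) n]; any [q] above [3 (gamma + e + 1) / e] will do. *)
Lemma aspect_ratio (R : realType) (gamma : R) : 0 <= gamma -> gamma != 1 ->
  exists2 q, (0 < q)%N & forall p : nat -> nat,
    (p n)%:R / n%:R @[n --> \oo] --> gamma ->
    \forall n \near \oo, (2 * q < maxn n (p n))%N /\
      (3 * maxn n (p n) <= q * (maxn n (p n) - minn n (p n)))%N.
Proof.
move=> g0 g1; pose e := `|gamma - 1| / 2.
have e0 : 0 < e by rewrite divr_gt0// normr_gt0 subr_eq0.
have far : 2 * e = `|gamma - 1| by rewrite /e mulrC divfK.
clearbody e; pose B := 3 * (gamma + e + 1) / e.
have B0 : 0 <= B by rewrite divr_ge0 ?mulr_ge0 ?addr_ge0// ltW.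
have /andP[_ Bq] := truncn_itv B0.
set q := (Num.truncn B).+1 in Bq; exists q => // p pg.
move/cvgrPdist_lt/(_ e e0): pg => pg.
near=> n.
have n2 : (2 * q < n)%N by near: n; exact: nbhs_infty_gt.
split; first by rewrite (leq_trans n2)// leq_maxl.
have n0 : 0 < n%:R :> R by rewrite ltr0n (leq_trans _ n2).
have : `|gamma - (p n)%:R / n%:R| < e by near: n.
set N := n%:R in n0 *; move: (p n) => k pe.
set r := k%:R / N in pe.
have kE : k%:R = r * N by rewrite divfK ?gt_eqF.
have gap : e * N <= `|k%:R - N|.
  have -> : k%:R - N = (r - 1) * N by rewrite mulrBl mul1r -kE.
  rewrite normrM (gtr0_norm n0) ler_pM2r//.
  have := ler_distD r gamma 1; move: pe far; lra.
have kN : k%:R <= (gamma + e) * N.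
  rewrite kE ler_pM2r//; move: pe; rewrite ltr_norml => /andP[]; lra.
have maxE : (maxn n k)%:R <= (gamma + e + 1) * N.
  have gN : 0 <= (gamma + e) * N by rewrite mulr_ge0 ?addr_ge0 ?(ltW e0) ?(ltW n0).
  by case: (leqP n k) => _; rewrite ?[n%:R]/N; move: kN gN (ltW n0); lra.
have diffE : (maxn n k - minn n k)%:R = `|k%:R - N|.
  case: (leqP n k) => [nk|/ltnW kn]; rewrite natrB//.
    by rewrite ger0_norm// subr_ge0 ler_nat.
  by rewrite ler0_norm ?opprB// subr_le0 ler_nat.
rewrite -(ler_nat R) !natrM diffE.
apply: (le_trans (ler_wpM2l _ maxE)) => //.
apply: (@le_trans _ _ (q%:R * (e * N))); last by rewrite ler_wpM2l.
rewrite !mulrA ler_pM2r// -ler_pdivrMr//; exact: ltW.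
Unshelve. all: by end_near. Qed.

Theorem theorem3p3 (R : realType) (c_m c_M : R) (hc_m : 0 < c_m)
    (hc_M : c_m <= c_M) :
  (forall (p : nat -> nat) (d : nat -> measure_display)
      (Omega : forall n, measurableType (d n))
      (P : forall n, probability (Omega n) R)
      (Sigma : forall n, 'M[R]_(p n))
      (X : forall n, Omega n -> 'M[R]_(n, p n))
      (b theta0 : forall n, Omega n -> 'cV[R]_(p n)) (eps : R),
    gaussian_gd_setting c_m c_M P Sigma X b theta0 ->
    0 < eps < 1 ->
    forall n : nat, (0 < n)%N ->
      {ae P n, forall w,
        (iteration_complexity eps (X n w) (b n w) (theta0 n w)
          <= (kappa (X n w) ^+ 2 * ln (1 / eps) + 1)%:E)%E})
  /\
  (forall gamma : R, 0 <= gamma -> gamma != 1 ->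
    exists2 C : R, 0 < C &
      forall (p : nat -> nat) (d : nat -> measure_display)
        (Omega : forall n, measurableType (d n))
        (P : forall n, probability (Omega n) R)
        (Sigma : forall n, 'M[R]_(p n))
        (X : forall n, Omega n -> 'M[R]_(n, p n))
        (b theta0 : forall n, Omega n -> 'cV[R]_(p n)) (eps : R),
      gaussian_gd_setting c_m c_M P Sigma X b theta0 ->
      (forall n, (0 < n)%N -> random_matrix (b n) /\ random_matrix (theta0 n)) ->
      0 < eps < 1 ->
      (p n)%:R / n%:R @[n --> \oo] --> gamma ->
      \forall n \near \oo,
        (\int[P n]_w iteration_complexity eps (X n w) (b n w) (theta0 n w)
          <= (C * ln (1 / eps) + 1)%:E)%E).
Proof.
set part1 := (X in X /\ _); have complexity : part1.
  move=> p d Omega P Sigma X b theta0 eps setting eps01 n n0.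
  have gX := gd_setting_gaussian_like setting n0.
  have [p0 _ _ rb _] := setting.
  apply: filterS2 (gaussian_like_gram_gt0 hc_m n0 (p0 n n0) gX) (rb n n0).
  by move=> w mu0; apply: iteration_complexity_le => //; exact: p0.
split=> // gamma g0 g1; have [q q0 ratio] := aspect_ratio g0 g1.
have [C C0 mean] := kappa_mean hc_m (le_trans (ltW hc_m) hc_M) q0.
exists C => // p d Omega P Sigma X b theta0 eps setting _ eps01 pg.
near=> n.
have n0 : (0 < n)%N by near: n; exact: nbhs_infty_gt.
have [qN gap] : (2 * q < maxn n (p n))%N /\
    (3 * maxn n (p n) <= q * (maxn n (p n) - minn n (p n)))%N.
  by near: n; exact: ratio.
have gX := gd_setting_gaussian_like setting n0.
have [p0 _ _ _ _] := setting.
have [Y [mY Y0 YC kY]] := mean _ _ _ _ _ _ gX n0 (p0 n n0) gap qN.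
have l0 : 0 <= ln (1 / eps).
  by case/andP: eps01 => e0 e1; rewrite ln_ge0// div1r invf_ge1// ltW.
have mYl : measurable_fun setT (fun w => Y w * (ln (1 / eps))%:E)%E.
  exact: emeasurable_funM.
have Yl0 w : (0 <= Y w * (ln (1 / eps))%:E)%E by rewrite mule_ge0.
apply: (@le_trans _ _ (\int[P n]_w (Y w * (ln (1 / eps))%:E + 1))%E).
  apply: ae_ge0_le_integral_nonmeasurable.
  - by move=> w; apply: le_ereal_inf_tmp => _ [t _ <-]; rewrite lee_fin.
  - exact: emeasurable_funD.
  - by move=> w; rewrite adde_ge0.
  - apply: filterS2 (complexity _ _ _ _ _ _ _ _ _ setting eps01 n n0) kY.
    move=> w h kw; apply: le_trans h _; rewrite EFinD EFinM leeD2r//.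
    by rewrite lee_wpmul2r.
rewrite ge0_integralD//= ge0_integralZr//= integral_cst//.
rewrite (_ : _ setT = 1%E) ?mule1; last exact: probability_setT.
by rewrite EFinD EFinM leeD2r// lee_wpmul2r.
Unshelve. all: by end_near. Qed.
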